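(* Let $K\neq0$, $\kappa=\sqrt{|K|}$, and let $A,B,C,D$ be four distinct points of an $\Re_K$ domain $(\mathcal M,\rho)$ such that $\rho(A,B)+\rho(B,C)+\rho(C,D)+\rho(D,A)<2\pi/\sqrt K$ if $K>0$. Put $a=\rho(A,B)$, $b=\rho(B,C)$, $c=\rho(C,D)$, $d=\rho(A,D)$, $e=\rho(B,D)$, $f=\rho(A,C)$. If $K>0$ then $$\cos\kappa a+\cos\kappa b+\cos\kappa c+\cos\kappa d\le4\cos\tfrac{\kappa e}{2}\cos\tfrac{\kappa f}{2},$$ and if $K<0$ then $$\cosh\kappa a+\cosh\kappa b+\cosh\kappa c+\cosh\kappa d\ge4\cosh\tfrac{\kappa e}{2}\cosh\tfrac{\kappa f}{2}.$$
   Context: $\Re_K$ domain: a metric space in which any two points are joined by a shortest (curve of length equal to their distance), in which (if $K>0$) every geodesic triangle has perimeter $<2\pi/\sqrt K$, and every geodesic triangle $ABC$ (three distinct points with pairwise joining shortests) has sum of upper angles between its sides at its three vertices at most $\angle_KBAC+\angle_KABC+\angle_KACB$; here $\angle_K$ is the corresponding angle of a triangle with the same side lengths in the model plane $\mathbb S_K$ (open hemisphere of radius $1/\sqrt K$ of the round sphere if $K>0$, hyperbolic plane of curvature $K$ if $K<0$), and the upper angle between shortests $\mathcal L,\mathcal N$ from $O$ is $\limsup\angle_0XOY$ as $X\to O$ in $\mathcal L\setminus\{O\}$, $Y\to O$ in $\mathcal N\setminus\{O\}$ ($\angle_0$ the Euclidean comparison angle). *)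

(* Defs.v *)
From Stdlib Require Import Reals Lra List.
Open Scope R_scope.

Definition is_metric {M : Type} (rho : M -> M -> R) : Prop :=
  (forall x y, 0 <= rho x y) /\
  (forall x y, rho x y = 0 <-> x = y) /\
  (forall x y, rho x y = rho y x) /\
  (forall x y z, rho x z <= rho x y + rho y z).

Definition curve_continuous {M : Type} (rho : M -> M -> R)
  (gam : R -> M) (a b : R) : Prop :=
  forall t, a <= t <= b -> forall eps, 0 < eps -> exists del, 0 < del /\
    forall s, a <= s <= b -> Rabs (s - t) < del -> rho (gam t) (gam s) < eps.

Fixpoint is_partition_from (t0 : R) (ts : list R) (b : R) : Prop :=
  match ts with
  | nil => t0 = b
  | t :: ts' => t0 <= t /\ is_partition_from t ts' b
  end.

Fixpoint partition_sum {M : Type} (rho : M -> M -> R) (gam : R -> M)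
  (t0 : R) (ts : list R) : R :=
  match ts with
  | nil => 0
  | t :: ts' => rho (gam t0) (gam t) + partition_sum rho gam t ts'
  end.

Definition curve_length {M : Type} (rho : M -> M -> R)
  (gam : R -> M) (a b L : R) : Prop :=
  is_lub (fun s => exists ts, is_partition_from a ts b /\
                     s = partition_sum rho gam a ts) L.

Definition is_shortest {M : Type} (rho : M -> M -> R)
  (gam : R -> M) (a b : R) (X Y : M) : Prop :=
  a <= b /\ curve_continuous rho gam a b /\ gam a = X /\ gam b = Y /\
  curve_length rho gam a b (rho X Y).

Definition curve_image {M : Type} (gam : R -> M) (a b : R) : M -> Prop :=
  fun P => exists t, a <= t <= b /\ gam t = P.

(** Euclidean comparison angle angle_0 XOY (law of cosines). *)
Definition eucl_angle {M : Type} (rho : M -> M -> R) (X O Y : M) : R :=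
  let x := rho O X in let y := rho O Y in let z := rho X Y in
  acos ((x ^ 2 + y ^ 2 - z ^ 2) / (2 * x * y)).

(** Angle at the vertex opposite to side z of a triangle with sides x, y, z
    in the model plane S_K (law of cosines of curvature K). *)
Definition model_angle (K x y z : R) : R :=
  let k := sqrt (Rabs K) in
  if Rlt_dec 0 K then
    acos ((cos (k * z) - cos (k * x) * cos (k * y)) / (sin (k * x) * sin (k * y)))
  else if Rlt_dec K 0 then
    acos ((cosh (k * x) * cosh (k * y) - cosh (k * z)) / (sinh (k * x) * sinh (k * y)))
  else acos ((x ^ 2 + y ^ 2 - z ^ 2) / (2 * x * y)).

Definition angK {M : Type} (rho : M -> M -> R) (K : R) (B A C : M) : R :=
  model_angle K (rho A B) (rho A C) (rho B C).

Definition is_glb (S : R -> Prop) (m : R) : Prop :=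
  (forall x, S x -> m <= x) /\ (forall m', (forall x, S x -> m' <= x) -> m' <= m).

(** Upper angle at O between point sets Ls, Ns (shortests from O):
    limsup of angle_0 XOY as X -> O in Ls \ {O}, Y -> O in Ns \ {O},
    i.e. the infimum over del > 0 of the supremum over X, Y within del of O. *)
Definition upper_angle {M : Type} (rho : M -> M -> R)
  (O : M) (Ls Ns : M -> Prop) (alpha : R) : Prop :=
  is_glb (fun s => exists del, 0 < del /\
            is_lub (fun v => exists X Y, Ls X /\ X <> O /\ rho O X < del /\
                                         Ns Y /\ Y <> O /\ rho O Y < del /\
                                         v = eucl_angle rho X O Y) s)
         alpha.

Definition is_RK_domain {M : Type} (rho : M -> M -> R) (K : R) : Prop :=
  is_metric rho /\
  (forall X Y : M, exists gam a b, is_shortest rho gam a b X Y) /\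
  (0 < K -> forall A B C : M, A <> B -> B <> C -> A <> C ->
     rho A B + rho B C + rho C A < 2 * PI / sqrt K) /\
  (forall (A B C : M) (g1 g2 g3 : R -> M) (a1 b1 a2 b2 a3 b3 : R)
          (alA alB alC : R),
     A <> B -> B <> C -> A <> C ->
     is_shortest rho g1 a1 b1 A B ->
     is_shortest rho g2 a2 b2 B C ->
     is_shortest rho g3 a3 b3 C A ->
     upper_angle rho A (curve_image g1 a1 b1) (curve_image g3 a3 b3) alA ->
     upper_angle rho B (curve_image g1 a1 b1) (curve_image g2 a2 b2) alB ->
     upper_angle rho C (curve_image g2 a2 b2) (curve_image g3 a3 b3) alC ->
     alA + alB + alC <= angK rho K B A C + angK rho K A B C + angK rho K A C B).

(* Main.v *)
(** If the angle between two geodesics from [O] exceeded its comparison angle at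
    some pair of points, the angle sum condition would leave one of the other two
    vertices with an angle below its comparison angle by a definite amount. By the
    first variation inequality, sliding that vertex towards [O] lowers the
    comparison angle at [O] at a rate at least proportional to [1 / side], which
    cannot go on since the angle stays nonnegative while [ln side] tends to
    minus infinity. Hence every angle is at most its comparison angle. The two
    angles at the midpoint [Z] of [AC] add up to at least [PI], so the law of
    cosines gives the median inequality
    [cos a + cos b <= 2 cos (f / 2) cos (BZ)], and likewise for [D]. Adding both and
    using [cos (BZ) + cos (DZ) <= 2 cos (e / 2)], a consequence of
    [e <= BZ + DZ], gives the claim; the hyperbolic case is the same with the
    inequalities reversed. *)

(* The slide towards [O] is not iterated: single slides have no uniform length, so they could
   accumulate at a positive side. Instead, the comparison angle at [O] minus [k] times the
   logarithms of both sides is minimised over a compact rectangle of side lengths. The rectangle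
   reaches down so far that the logarithms outweigh every angle on its two lower edges, so the
   minimum lies off them; slides only shorten sides, so the upper edges do no harm, and one slide
   from the minimum is already a contradiction. The rate [1 / side] arises as follows. In the model
   plane, pushing [X] towards [O] shortens the opposite side at a rate equal to the cosine of the
   angle at [X], the angle at [O] being fixed. A smaller true angle at [X] gives a faster
   shortening, hence a smaller comparison angle at [O], and the law of sines makes the gain
   independent of how thin the triangle is. Since [acos] is not differentiable at 1 and -1,
   comparison angles 0 and [PI] must be excluded first. *)
Require Import Defs.
From Stdlib Require Import Reals Lra Psatz List Classical IndefiniteDescription.
From Coquelicot Require Import Coquelicot.
Open Scope R_scope.

(** * The arc cosine *)

Lemma sin_mid_ge (d s : R) : 0 <= d -> d <= s -> s <= PI - d -> sin d <= sin s.
Proof.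
  intros Hd H1 H2.
  pose proof PI_RGT_0.
  destruct (Rle_dec s (PI / 2)).
  - apply sin_incr_1; lra.
  - rewrite <- (sin_PI_x s). apply sin_incr_1; lra.
Qed.

(** In the product form of the difference, both half arguments lie between [d / 2] and [PI - d / 2],
    where the sine is at least [sin (d / 2)]. *)
Lemma cos_gap (d s t : R) :
  0 <= d -> 0 <= s -> s + d <= t -> t <= PI -> 2 * sin (d / 2) ^ 2 <= cos s - cos t.
Proof.
  intros Hd Hs Hst Ht.
  pose proof PI_RGT_0.
  rewrite form2.
  replace ((s - t) / 2) with (- ((t - s) / 2)) by lra.
  rewrite sin_neg.
  assert (H1 : sin (d / 2) <= sin ((t - s) / 2)) by (apply sin_mid_ge; lra).
  assert (H2 : sin (d / 2) <= sin ((s + t) / 2)) by (apply sin_mid_ge; lra).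
  assert (H0 : 0 <= sin (d / 2)) by (apply sin_ge_0; lra).
  nra.
Qed.

Lemma acos_le_m1 (x : R) : x <= -1 -> acos x = PI.
Proof.
  intros Hx. unfold acos, asin.
  destruct (Rle_dec x (-1)); lra.
Qed.

Lemma acos_ge_1 (x : R) : 1 <= x -> acos x = 0.
Proof.
  intros Hx. unfold acos, asin.
  destruct (Rle_dec x (-1)); [lra|].
  destruct (Rle_dec 1 x); lra.
Qed.

(** [acos] is constant on either side of [-1, 1], so no range condition is needed. This quantitative
    form yields both monotonicity and continuity, the latter also at 1 and -1. *)
Lemma acos_gap (d x y : R) :
  0 < d -> acos y + d <= acos x -> 2 * sin (d / 2) ^ 2 <= y - x.
Proof.
  intros Hd H.
  pose proof (acos_bound x). pose proof (acos_bound y).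
  pose proof (cos_gap d (acos y) (acos x)) as G.
  assert (Hx : cos (acos x) >= x).
  { destruct (Rle_dec x (-1)) as [h|h].
    - rewrite (acos_le_m1 x h), cos_PI. lra.
    - destruct (Rle_dec 1 x) as [h'|h'].
      + rewrite (acos_ge_1 x h') in H. lra.
      + rewrite cos_acos; lra. }
  assert (Hy : cos (acos y) <= y).
  { destruct (Rle_dec y (-1)) as [h|h].
    - rewrite (acos_le_m1 y h) in H. lra.
    - destruct (Rle_dec 1 y) as [h'|h'].
      + rewrite (acos_ge_1 y h'), cos_0. lra.
      + rewrite cos_acos; lra. }
  lra.
Qed.

Lemma sin_half_sqr_pos (d : R) : 0 < d -> d <= PI -> 0 < sin (d / 2) ^ 2.
Proof.
  intros H1 H2. apply pow_lt, sin_gt_0; lra.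
Qed.

Lemma acos_decr (x y : R) : x <= y -> acos y <= acos x.
Proof.
  intros H. apply Rnot_lt_le. intros H'.
  pose proof (acos_bound x). pose proof (acos_bound y).
  assert (G := acos_gap (acos y - acos x) y x).
  assert (0 < sin ((acos y - acos x) / 2) ^ 2) by (apply sin_half_sqr_pos; lra).
  lra.
Qed.

Lemma continuous_acos (x : R) : continuous acos x.
Proof.
  apply continuity_pt_filterlim.
  intros eps Heps.
  set (d := Rmin eps PI).
  assert (Hd : 0 < d <= PI).
  { unfold d. split; [apply Rmin_pos; [lra | apply PI_RGT_0] | apply Rmin_r]. }
  assert (Hde : d <= eps) by apply Rmin_l.
  pose proof (sin_half_sqr_pos d ltac:(lra) ltac:(lra)) as Hp.
  exists (2 * sin (d / 2) ^ 2). split; [lra|].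
  intros y [_ Hy]. simpl in Hy |- *. unfold Rdist in *.
  apply Rabs_def2 in Hy.
  apply Rabs_def1; apply Rnot_le_lt; intros H.
  - pose proof (acos_gap d y x ltac:(lra) ltac:(lra)). lra.
  - pose proof (acos_gap d x y ltac:(lra) ltac:(lra)). lra.
Qed.

Lemma is_derive_acos (x : R) : -1 < x < 1 -> is_derive acos x (- / sqrt (1 - x ^ 2)).
Proof.
  intros Hx. apply is_derive_Reals.
  replace (- / sqrt (1 - x ^ 2)) with (derive_pt acos x (derivable_pt_acos x Hx)).
  - apply (proj1 (derive_pt_eq _ _ _ (derivable_pt_acos x Hx))). reflexivity.
  - rewrite derive_pt_acos. replace (Rsqr x) with (x ^ 2) by (unfold Rsqr; ring).
    unfold Rdiv. ring.
Qed.

(** * Trigonometry of the model planes *)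

Definition curv_rate (K : R) : R := sqrt (Rabs K).

(** Generalised cosine and sine of curvature [K]. With the divisor [curv_rate K] in [snK], the rules
    [csK' = - K snK], [snK' = csK] and [csK ^ 2 + K snK ^ 2 = 1] hold for both signs of [K], which
    can then be treated together. *)
Definition csK (K t : R) : R :=
  if Rlt_dec 0 K then cos (curv_rate K * t) else cosh (curv_rate K * t).

Definition snK (K t : R) : R :=
  if Rlt_dec 0 K then sin (curv_rate K * t) / curv_rate K
  else sinh (curv_rate K * t) / curv_rate K.

(** For [K > 0], lengths below half a great circle: there [snK] is positive and [csK] monotone. *)
Definition in_range (K t : R) : Prop := 0 < K -> curv_rate K * t < PI.

Lemma curv_rate_pos (K : R) : K <> 0 -> 0 < curv_rate K.
Proof. intros H. apply sqrt_lt_R0, Rabs_pos_lt, H. Qed.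

Lemma curv_rate_sqr (K : R) : curv_rate K * curv_rate K = Rabs K.
Proof. apply sqrt_sqrt, Rabs_pos. Qed.

(** Replaces [K] by plus or minus the square of the rate, so that [field] can cancel the powers of
    the rate. *)
Ltac curv_field HK Hq :=
  match type of HK with
  | ?K <> 0 =>
      set (k := curv_rate K) in *; clearbody k;
      first [assert (EK : K = k * k) by lra | assert (EK : K = - (k * k)) by lra];
      clear HK Hq; subst K; field; lra
  end.

Lemma csK_neg (K t : R) : K < 0 -> csK K t = cosh (curv_rate K * t).
Proof. intros H. unfold csK. destruct (Rlt_dec 0 K); lra. Qed.

Lemma csK_pos (K t : R) : 0 < K -> csK K t = cos (curv_rate K * t).
Proof. intros H. unfold csK. destruct (Rlt_dec 0 K); lra. Qed.

Lemma snK_neg (K t : R) : K < 0 -> snK K t = sinh (curv_rate K * t) / curv_rate K.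
Proof. intros H. unfold snK. destruct (Rlt_dec 0 K); lra. Qed.

Lemma snK_pos (K t : R) : 0 < K -> snK K t = sin (curv_rate K * t) / curv_rate K.
Proof. intros H. unfold snK. destruct (Rlt_dec 0 K); lra. Qed.

Lemma cosh_minus (x y : R) : cosh (x - y) = cosh x * cosh y - sinh x * sinh y.
Proof.
  unfold cosh, sinh. replace (- (x - y)) with (- x + y) by ring.
  unfold Rminus at 1. rewrite !exp_plus. field.
Qed.

Lemma cosh_plus (x y : R) : cosh (x + y) = cosh x * cosh y + sinh x * sinh y.
Proof.
  unfold cosh, sinh. replace (- (x + y)) with (- x + - y) by ring.
  rewrite !exp_plus. field.
Qed.

Lemma cosh_ge_1 (x : R) : 1 <= cosh x.
Proof.
  unfold cosh.
  assert (exp x * exp (- x) = 1) by (rewrite <- exp_plus, Rplus_opp_r; apply exp_0).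
  pose proof (exp_pos x). pose proof (exp_pos (- x)).
  pose proof (Rle_0_sqr (exp x - exp (- x))) as Hs. unfold Rsqr in Hs. nra.
Qed.

Lemma sinh_ge_0 (x : R) : 0 <= x -> 0 <= sinh x.
Proof.
  intros H. destruct (Req_dec x 0) as [->|Hn].
  - rewrite sinh_0. lra.
  - rewrite <- sinh_0. apply Rlt_le, sinh_lt. lra.
Qed.

Lemma sinh_gt_0 (x : R) : 0 < x -> 0 < sinh x.
Proof. intros H. rewrite <- sinh_0. apply sinh_lt, H. Qed.

Lemma cosh_incr (x y : R) : 0 <= x -> x <= y -> cosh x <= cosh y.
Proof.
  intros Hx Hy. replace y with (x + (y - x)) by ring.
  rewrite cosh_plus.
  pose proof (cosh_ge_1 x). pose proof (cosh_ge_1 (y - x)).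
  pose proof (sinh_ge_0 x Hx). pose proof (sinh_ge_0 (y - x) ltac:(lra)). nra.
Qed.

Lemma csK_sqr (K t : R) : K <> 0 -> csK K t ^ 2 + K * snK K t ^ 2 = 1.
Proof.
  intros HK. pose proof (curv_rate_pos K HK) as Hk.
  pose proof (curv_rate_sqr K) as Hq.
  destruct (Rtotal_order K 0) as [h|[h|h]]; [|lra|].
  - rewrite csK_neg, snK_neg by lra. rewrite Rabs_left in Hq by lra.
    replace (K * (sinh (curv_rate K * t) / curv_rate K) ^ 2)
      with (- sinh (curv_rate K * t) ^ 2)
      by curv_field HK Hq.
    pose proof (cosh_minus (curv_rate K * t) (curv_rate K * t)) as E.
    rewrite Rminus_diag, cosh_0 in E. nra.
  - rewrite csK_pos, snK_pos by lra. rewrite Rabs_right in Hq by lra.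
    replace (K * (sin (curv_rate K * t) / curv_rate K) ^ 2)
      with (sin (curv_rate K * t) ^ 2)
      by curv_field HK Hq.
    pose proof (sin2_cos2 (curv_rate K * t)) as E. unfold Rsqr in E. nra.
Qed.

Lemma csK_minus (K s t : R) :
  K <> 0 -> csK K (s - t) = csK K s * csK K t + K * snK K s * snK K t.
Proof.
  intros HK. pose proof (curv_rate_pos K HK) as Hk.
  pose proof (curv_rate_sqr K) as Hq.
  destruct (Rtotal_order K 0) as [h|[h|h]]; [|lra|].
  - rewrite !csK_neg, !snK_neg by lra. rewrite Rabs_left in Hq by lra.
    rewrite Rmult_minus_distr_l, cosh_minus.
    curv_field HK Hq.
  - rewrite !csK_pos, !snK_pos by lra. rewrite Rabs_right in Hq by lra.
    rewrite Rmult_minus_distr_l, cos_minus.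
    curv_field HK Hq.
Qed.

Lemma csK_opp (K t : R) : csK K (- t) = csK K t.
Proof.
  unfold csK. rewrite Ropp_mult_distr_r_reverse. destruct (Rlt_dec 0 K).
  - apply cos_neg.
  - unfold cosh. rewrite Ropp_involutive. field.
Qed.

Lemma snK_opp (K t : R) : snK K (- t) = - snK K t.
Proof.
  unfold snK. rewrite Ropp_mult_distr_r_reverse. destruct (Rlt_dec 0 K).
  - rewrite sin_neg. unfold Rdiv. ring.
  - unfold sinh, Rdiv. rewrite Ropp_involutive. ring.
Qed.

Lemma csK_plus (K s t : R) :
  K <> 0 -> csK K (s + t) = csK K s * csK K t - K * snK K s * snK K t.
Proof.
  intros HK. replace (s + t) with (s - - t) by ring.
  rewrite csK_minus, csK_opp, snK_opp by exact HK. ring.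
Qed.

Lemma csK_0 (K : R) : csK K 0 = 1.
Proof.
  unfold csK. rewrite Rmult_0_r. destruct (Rlt_dec 0 K); [apply cos_0 | apply cosh_0].
Qed.

Lemma is_derive_csK (K t : R) : K <> 0 -> is_derive (csK K) t (- K * snK K t).
Proof.
  intros HK. pose proof (curv_rate_pos K HK) as Hk.
  pose proof (curv_rate_sqr K) as Hq.
  destruct (Rtotal_order K 0) as [h|[h|h]]; [|lra|].
  - rewrite snK_neg by lra. rewrite Rabs_left in Hq by lra.
    apply is_derive_ext with (fun t => cosh (curv_rate K * t)).
    { intros u. symmetry. apply csK_neg, h. }
    replace (- K * (sinh (curv_rate K * t) / curv_rate K))
      with (scal (curv_rate K) (sinh (curv_rate K * t))).
    + apply (is_derive_comp cosh (fun t => curv_rate K * t)).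
      * apply is_derive_Reals, derivable_pt_lim_cosh.
      * auto_derive; [exact I | ring].
    + unfold scal; simpl; unfold mult; simpl.
      replace (- K) with (curv_rate K * curv_rate K) by lra. field; lra.
  - rewrite snK_pos by lra. rewrite Rabs_right in Hq by lra.
    apply is_derive_ext with (fun t => cos (curv_rate K * t)).
    { intros u. symmetry. apply csK_pos, h. }
    auto_derive; [exact I|].
    replace (- K) with (- (curv_rate K * curv_rate K)) by lra. field; lra.
Qed.

Lemma is_derive_snK (K t : R) : K <> 0 -> is_derive (snK K) t (csK K t).
Proof.
  intros HK. pose proof (curv_rate_pos K HK) as Hk.
  destruct (Rtotal_order K 0) as [h|[h|h]]; [|lra|].
  - rewrite csK_neg by lra.
    apply is_derive_ext with (fun t => / curv_rate K * sinh (curv_rate K * t)).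
    { intros u. rewrite (snK_neg K u h). apply Rmult_comm. }
    replace (cosh (curv_rate K * t))
      with (/ curv_rate K * scal (curv_rate K) (cosh (curv_rate K * t))).
    + apply is_derive_scal.
      apply (is_derive_comp sinh (fun t => curv_rate K * t)).
      * apply is_derive_Reals, derivable_pt_lim_sinh.
      * auto_derive; [exact I | ring].
    + unfold scal; simpl; unfold mult; simpl. field; lra.
  - rewrite csK_pos by lra.
    apply is_derive_ext with (fun t => sin (curv_rate K * t) / curv_rate K).
    { intros u. symmetry. apply snK_pos, h. }
    auto_derive; [exact I|]. field; lra.
Qed.

Lemma snK_gt_0 (K t : R) : K <> 0 -> 0 < t -> in_range K t -> 0 < snK K t.
Proof.
  intros HK Ht Hr. pose proof (curv_rate_pos K HK) as Hk.
  assert (0 < curv_rate K * t) by (apply Rmult_lt_0_compat; lra).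
  destruct (Rtotal_order K 0) as [h|[h|h]]; [|lra|].
  - rewrite snK_neg by lra. apply Rdiv_lt_0_compat; [apply sinh_gt_0|]; lra.
  - rewrite snK_pos by lra. apply Rdiv_lt_0_compat; [|lra].
    apply sin_gt_0; [lra | apply Hr, h].
Qed.

(** The factor [K] merges the two cases: the cosine decreases, the hyperbolic cosine increases, and
    a negative [K] reverses the latter. *)
Lemma csK_mono (K s t : R) :
  K <> 0 -> 0 <= s -> s <= t -> (0 < K -> curv_rate K * t <= PI) ->
  K * csK K t <= K * csK K s.
Proof.
  intros HK Hs Ht Hr. pose proof (curv_rate_pos K HK) as Hk.
  assert (0 <= curv_rate K * s) by (apply Rmult_le_pos; lra).
  assert (curv_rate K * s <= curv_rate K * t) by (apply Rmult_le_compat_l; lra).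
  destruct (Rtotal_order K 0) as [h|[h|h]]; [|lra|].
  - rewrite !csK_neg by lra.
    pose proof (cosh_incr (curv_rate K * s) (curv_rate K * t)). nra.
  - rewrite !csK_pos by lra. specialize (Hr h).
    apply Rmult_le_compat_l; [lra|]. apply cos_decr_1; lra.
Qed.

(* Cosine of the angle between the sides [x], [y] of a model triangle whose
   third side is [z]. *)
Definition ang_cos (K x y z : R) : R :=
  (csK K z - csK K x * csK K y) / (K * snK K x * snK K y).

Lemma ang_cos_sym (K x y z : R) : ang_cos K x y z = ang_cos K y x z.
Proof.
  unfold ang_cos. rewrite (Rmult_comm (csK K x)).
  replace (K * snK K x * snK K y) with (K * snK K y * snK K x) by ring. reflexivity.
Qed.

Lemma model_angle_ang_cos (K x y z : R) :
  K <> 0 -> model_angle K x y z = acos (ang_cos K x y z).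
Proof.
  intros HK. pose proof (curv_rate_pos K HK) as Hk.
  pose proof (curv_rate_sqr K) as Hq.
  unfold model_angle, ang_cos. fold (curv_rate K).
  destruct (Rlt_dec 0 K) as [h|h]; [|destruct (Rlt_dec K 0) as [h'|h']; [|lra]].
  - rewrite !csK_pos, !snK_pos by lra. rewrite Rabs_right in Hq by lra. f_equal.
    replace (K * (sin (curv_rate K * x) / curv_rate K) * (sin (curv_rate K * y) / curv_rate K))
      with (sin (curv_rate K * x) * sin (curv_rate K * y)); [reflexivity|].
    curv_field HK Hq.
  - rewrite !csK_neg, !snK_neg by lra. rewrite Rabs_left in Hq by lra. f_equal.
    replace (K * (sinh (curv_rate K * x) / curv_rate K) * (sinh (curv_rate K * y) / curv_rate K))
      with (- (sinh (curv_rate K * x) * sinh (curv_rate K * y))).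
    + unfold Rdiv. rewrite Rinv_opp. ring.
    + curv_field HK Hq.
Qed.

Definition model_triangle (K x y z : R) : Prop :=
  0 <= x /\ 0 <= y /\ 0 <= z /\ x <= y + z /\ y <= x + z /\ z <= x + y /\
  (0 < K -> curv_rate K * (x + y + z) < 2 * PI).

Lemma model_triangle_in_range (K x y z : R) :
  K <> 0 -> model_triangle K x y z -> in_range K x /\ in_range K y /\ in_range K z.
Proof.
  intros HK (Hx & Hy & Hz & H1 & H2 & H3 & H4).
  pose proof (curv_rate_pos K HK) as Hk.
  repeat split; intros h; specialize (H4 h); nra.
Qed.

(** The bounds 1 and -1 are the addition formulas for [x - y] and [x + y], compared with [z] by
    monotonicity. *)
Lemma ang_cos_bound (K x y z : R) :
  K <> 0 -> 0 < x -> 0 < y -> model_triangle K x y z -> -1 <= ang_cos K x y z <= 1.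
Proof.
  intros HK Hx Hy HT.
  pose proof (model_triangle_in_range K x y z HK HT) as (Rx & Ry & Rz).
  destruct HT as (_ & _ & Hz & H1 & H2 & H3 & H4).
  pose proof (curv_rate_pos K HK) as Hk.
  pose proof (snK_gt_0 K x HK Hx Rx) as Sx.
  pose proof (snK_gt_0 K y HK Hy Ry) as Sy.
  set (N := csK K z - csK K x * csK K y).
  assert (B1 : K * csK K z <= K * csK K (x - y)).
  { destruct (Rle_dec 0 (x - y)).
    - apply csK_mono; [exact HK | lra | lra | intros h; specialize (Rz h); lra].
    - rewrite <- (csK_opp K (x - y)).
      apply csK_mono; [exact HK | lra | lra | intros h; specialize (Rz h); lra]. }
  assert (B2 : K * csK K (x + y) <= K * csK K z).
  { destruct (Rtotal_order K 0) as [h|[h|h]]; [|lra|].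
    - apply csK_mono; lra.
    - specialize (Rz h). specialize (H4 h).
      destruct (Rle_dec (curv_rate K * (x + y)) PI).
      + apply csK_mono; lra.
      (* Here [x + y] exceeds half a great circle. The rest of the full circle has the same cosine
         and is longer than [z] by the perimeter bound. *)
      + rewrite !csK_pos by lra. apply Rmult_le_compat_l; [lra|].
        replace (cos (curv_rate K * (x + y))) with (cos (2 * PI - curv_rate K * (x + y))).
        * assert (0 <= curv_rate K * z) by (apply Rmult_le_pos; lra).
          apply cos_decr_1; lra.
        * rewrite cos_minus, cos_2PI, sin_2PI. ring. }
  rewrite csK_minus in B1 by exact HK. rewrite csK_plus in B2 by exact HK.
  (* Expanding the fraction by [K] makes the denominator positive for either sign. *)
  assert (E : ang_cos K x y z = K * N / (K ^ 2 * (snK K x * snK K y))).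
  { unfold ang_cos, N. field. repeat split; lra. }
  assert (P : 0 < K ^ 2 * (snK K x * snK K y)).
  { apply Rmult_lt_0_compat; [|apply Rmult_lt_0_compat; lra].
    rewrite <- Rsqr_pow2. apply Rsqr_pos_lt, HK. }
  rewrite E. unfold N. split.
  - apply Rle_div_r; [lra|]. nra.
  - apply Rle_div_l; [lra|]. nra.
Qed.

Lemma ang_cos_law (K x y z : R) :
  K <> 0 -> 0 < snK K x -> 0 < snK K y ->
  csK K z = csK K x * csK K y + K * snK K x * snK K y * ang_cos K x y z.
Proof. intros. unfold ang_cos. field. repeat split; lra. Qed.

Lemma ang_cos_mono (K x y z z' : R) :
  K <> 0 -> 0 < snK K x -> 0 < snK K y -> 0 <= z -> z <= z' ->
  (0 < K -> curv_rate K * z' <= PI) ->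
  ang_cos K x y z' <= ang_cos K x y z.
Proof.
  intros HK Sx Sy Hz Hz' Hr.
  pose proof (csK_mono K z z' HK Hz Hz' Hr) as H.
  rewrite (ang_cos_law K x y z), (ang_cos_law K x y z') in H by assumption.
  assert (P : 0 < K ^ 2 * (snK K x * snK K y)).
  { apply Rmult_lt_0_compat; [|apply Rmult_lt_0_compat; lra].
    rewrite <- Rsqr_pow2. apply Rsqr_pos_lt, HK. }
  apply Rmult_le_reg_l with (1 := P). nra.
Qed.

(** Multiplied by [K ^ 2 * snK K x ^ 2], both sides become [1 - cx ^ 2 - cy ^ 2 - cz ^ 2 + 2 * cx *
    cy * cz], which is symmetric in the three sides. *)
Lemma model_sine_law (K x y z : R) :
  K <> 0 -> 0 < snK K x -> 0 < snK K y -> 0 < snK K z ->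
  snK K z ^ 2 * (1 - ang_cos K x z y ^ 2) = snK K y ^ 2 * (1 - ang_cos K x y z ^ 2).
Proof.
  intros HK Sx Sy Sz.
  pose proof (csK_sqr K x HK) as Ex. pose proof (csK_sqr K y HK) as Ey.
  pose proof (csK_sqr K z HK) as Ez.
  unfold ang_cos.
  set (X := snK K x) in *. set (Y := snK K y) in *. set (Z := snK K z) in *.
  set (cx := csK K x) in *. set (cy := csK K y) in *. set (cz := csK K z) in *.
  apply Rmult_eq_reg_l with (K ^ 2 * X ^ 2).
  2: { apply Rmult_integral_contrapositive_currified; apply pow_nonzero; lra. }
  replace (K ^ 2 * X ^ 2 * (Z ^ 2 * (1 - ((cy - cx * cz) / (K * X * Z)) ^ 2)))
    with ((K * X ^ 2) * (K * Z ^ 2) - (cy - cx * cz) ^ 2)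
    by (field; repeat split; lra).
  replace (K ^ 2 * X ^ 2 * (Y ^ 2 * (1 - ((cz - cx * cy) / (K * X * Y)) ^ 2)))
    with ((K * X ^ 2) * (K * Y ^ 2) - (cz - cx * cy) ^ 2)
    by (field; repeat split; lra).
  replace (K * X ^ 2) with (1 - cx ^ 2) by lra.
  replace (K * Y ^ 2) with (1 - cy ^ 2) by lra.
  replace (K * Z ^ 2) with (1 - cz ^ 2) by lra. ring.
Qed.

(** Side [x] shrinks at rate 1 and the opposite side [z] at rate [c]. The derivative vanishes
    exactly when [c] is the cosine of the model angle between [x] and [z], that is, when the motion
    takes place in the model plane with the angle at [O] fixed. *)
Lemma is_derive_ang_cos (K x y z c : R) :
  K <> 0 -> 0 < snK K x -> 0 < snK K y -> 0 < snK K z ->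
  is_derive (fun h => ang_cos K (x - h) y (z - c * h)) 0
    (snK K z / (snK K x * snK K y) * (c - ang_cos K x z y)).
Proof.
  intros HK Sx Sy Sz.
  assert (D1 : is_derive (fun h => csK K (x - h)) 0 (K * snK K x)).
  { replace (K * snK K x) with (scal (-1) (- K * snK K (x - 0)))
      by (unfold scal; simpl; unfold mult; simpl; rewrite Rminus_0_r; ring).
    apply (is_derive_comp (csK K) (fun h => x - h)).
    - apply is_derive_csK, HK.
    - auto_derive; [exact I | ring]. }
  assert (D2 : is_derive (fun h => snK K (x - h)) 0 (- csK K x)).
  { replace (- csK K x) with (scal (-1) (csK K (x - 0)))
      by (unfold scal; simpl; unfold mult; simpl; rewrite Rminus_0_r; ring).
    apply (is_derive_comp (snK K) (fun h => x - h)).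
    - apply is_derive_snK, HK.
    - auto_derive; [exact I | ring]. }
  assert (D3 : is_derive (fun h => csK K (z - c * h)) 0 (c * K * snK K z)).
  { replace (c * K * snK K z) with (scal (- c) (- K * snK K (z - c * 0)))
      by (unfold scal; simpl; unfold mult; simpl; rewrite Rmult_0_r, Rminus_0_r; ring).
    apply (is_derive_comp (csK K) (fun h => z - c * h)).
    - apply is_derive_csK, HK.
    - auto_derive; [exact I | ring]. }
  assert (H0 : K * snK K (x - 0) * snK K y <> 0).
  { rewrite Rminus_0_r. repeat apply Rmult_integral_contrapositive_currified; lra. }
  assert (Dn : is_derive (fun h => csK K (z - c * h) - csK K (x - h) * csK K y) 0
                 (c * K * snK K z - K * snK K x * csK K y)).
  { apply @is_derive_minus; [exact D3|].
    apply is_derive_ext with (fun h => csK K y * csK K (x - h));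
      [intros u; match goal with |- @eq _ ?a ?b => change (@eq R a b) end; ring|].
    replace (K * snK K x * csK K y) with (csK K y * (K * snK K x)) by ring.
    apply is_derive_scal, D1. }
  assert (Dd : is_derive (fun h => K * snK K (x - h) * snK K y) 0
                 (- K * snK K y * csK K x)).
  { apply is_derive_ext with (fun h => (K * snK K y) * snK K (x - h));
      [intros u; match goal with |- @eq _ ?a ?b => change (@eq R a b) end; ring|].
    replace (- K * snK K y * csK K x) with (K * snK K y * (- csK K x)) by ring.
    apply is_derive_scal, D2. }
  pose proof (is_derive_div _ _ _ _ _ Dn Dd H0) as D.
  unfold ang_cos at 1.
  evar (l : R). replace (snK K z / (snK K x * snK K y) * (c - ang_cos K x z y)) with l.
  { exact D. }
  unfold l, ang_cos. rewrite Rmult_0_r, !Rminus_0_r.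
  pose proof (csK_sqr K x HK) as Ex.
  apply Rminus_diag_uniq.
  (* The two expressions differ by a multiple of [csK ^ 2 + K snK ^ 2 - 1], which is isolated
     here. *)
  match goal with |- ?L = 0 =>
    replace L with (- csK K y * (csK K x ^ 2 + K * snK K x ^ 2 - 1) / (K * snK K x ^ 2 * snK K y))
  end.
  - rewrite Ex. field. repeat split; lra.
  - field. repeat split; lra.
Qed.

(** * Geodesics *)

(** A shortest in arc length parametrisation, as an isometric embedding of [0, [l]]: subarcs and
    reversals are then immediate and curve lengths disappear. *)
Definition geodesic {M : Type} (rho : M -> M -> R) (p : R -> M) (l : R) (X Y : M) : Prop :=
  0 <= l /\ p 0 = X /\ p l = Y /\
  forall s t, 0 <= s <= l -> 0 <= t <= l -> rho (p s) (p t) = Rabs (s - t).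

Lemma geodesic_length {M : Type} (rho : M -> M -> R) p l X Y :
  geodesic rho p l X Y -> rho X Y = l.
Proof.
  intros (Hl & H0 & H1 & Hi). rewrite <- H0, <- H1, Hi by lra.
  rewrite Rabs_left1; lra.
Qed.

Lemma geodesic_dist_start {M : Type} (rho : M -> M -> R) p l X Y s :
  geodesic rho p l X Y -> 0 <= s <= l -> rho X (p s) = s.
Proof.
  intros (Hl & H0 & H1 & Hi) Hs. rewrite <- H0, Hi by lra.
  rewrite Rabs_left1; lra.
Qed.

Lemma geodesic_dist_end {M : Type} (rho : M -> M -> R) p l X Y s :
  geodesic rho p l X Y -> 0 <= s <= l -> rho (p s) Y = l - s.
Proof.
  intros (Hl & H0 & H1 & Hi) Hs. rewrite <- H1, Hi by lra.
  rewrite Rabs_left1; lra.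
Qed.

Lemma geodesic_rev {M : Type} (rho : M -> M -> R) p l X Y :
  geodesic rho p l X Y -> geodesic rho (fun s => p (l - s)) l Y X.
Proof.
  intros (Hl & H0 & H1 & Hi). repeat split; [exact Hl | | |].
  - now rewrite Rminus_0_r.
  - now rewrite Rminus_diag.
  - intros s t Hs Ht. rewrite Hi by lra. rewrite Rabs_minus_sym. f_equal; lra.
Qed.

Lemma geodesic_initial {M : Type} (rho : M -> M -> R) p l X Y x :
  geodesic rho p l X Y -> 0 <= x <= l -> geodesic rho p x X (p x).
Proof.
  intros (Hl & H0 & H1 & Hi) Hx. repeat split; [lra | exact H0 |].
  intros s t Hs Ht. apply Hi; lra.
Qed.

Lemma geodesic_final {M : Type} (rho : M -> M -> R) p l X Y x :
  geodesic rho p l X Y -> 0 <= x <= l ->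
  geodesic rho (fun s => p (x + s)) (l - x) (p x) Y.
Proof.
  intros (Hl & H0 & H1 & Hi) Hx. repeat split; [lra | | |].
  - now rewrite Rplus_0_r.
  - now replace (x + (l - x)) with l by ring.
  - intros s t Hs Ht. rewrite Hi by lra. f_equal; lra.
Qed.

Lemma partition_le (ts : list R) (t b : R) : is_partition_from t ts b -> t <= b.
Proof.
  revert t. induction ts as [|u ts IH]; intros t; simpl.
  - intros ->. lra.
  - intros [H1 H2]. specialize (IH _ H2). lra.
Qed.

Lemma partition_sum_geodesic {M : Type} (rho : M -> M -> R) p l X Y ts t0 :
  geodesic rho p l X Y -> 0 <= t0 -> is_partition_from t0 ts l ->
  partition_sum rho p t0 ts = l - t0.
Proof.
  intros (Hl & H0 & H1 & Hi). revert t0.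
  induction ts as [|u ts IH]; intros t0 Ht0; simpl.
  - intros ->. lra.
  - intros [Hu Hts]. pose proof (partition_le _ _ _ Hts).
    rewrite IH, Hi by (lra || assumption). rewrite Rabs_left1; lra.
Qed.

Lemma geodesic_is_shortest {M : Type} (rho : M -> M -> R) p l X Y :
  geodesic rho p l X Y -> is_shortest rho p 0 l X Y.
Proof.
  intros G. pose proof (geodesic_length _ _ _ _ _ G) as E.
  pose proof G as (Hl & H0 & H1 & Hi).
  split; [exact Hl|]. split.
  { intros t Ht eps Heps. exists eps. split; [exact Heps|].
    intros s Hs Hst. rewrite Hi, Rabs_minus_sym by assumption. exact Hst. }
  split; [exact H0|]. split; [exact H1|].
  rewrite E. split.
  - intros s (ts & Hts & ->).
    rewrite (partition_sum_geodesic rho p l X Y ts 0 G) by (lra || assumption). lra.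
  - intros B HB. apply HB. exists (l :: nil). split.
    + simpl. split; [lra | reflexivity].
    + rewrite (partition_sum_geodesic rho p l X Y _ 0 G); [lra | lra |].
      simpl. split; [lra | reflexivity].
Qed.

(** A 1-Lipschitz retraction onto [[a], [b]]; it extends functions on an interval to the whole
    line. *)
Definition clamp (a b t : R) : R := Rmax a (Rmin b t).

Lemma clamp_bound (a b t : R) : a <= b -> a <= clamp a b t <= b.
Proof.
  intros H. unfold clamp. split; [apply Rmax_l|].
  apply Rmax_lub; [exact H | apply Rmin_l].
Qed.

Lemma clamp_id (a b t : R) : a <= t <= b -> clamp a b t = t.
Proof.
  intros H. unfold clamp. rewrite Rmin_right, Rmax_right; lra.
Qed.

Lemma clamp_contract (a b s t : R) : Rabs (clamp a b s - clamp a b t) <= Rabs (s - t).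
Proof.
  unfold clamp, Rmax, Rmin. pose proof (Rle_abs (s - t)).
  pose proof (Rle_abs (- (s - t))) as H'. rewrite Rabs_Ropp in H'.
  repeat destruct Rle_dec; apply Rabs_le; lra.
Qed.

(** The distance from [X] serves as arc length: the intermediate value theorem finds a point of the
    curve at each distance, and partition sums, being bounded by [rho X Y], leave no slack in the
    triangle inequality. *)
Lemma shortest_geodesic {M : Type} (rho : M -> M -> R) gam a b X Y :
  is_metric rho -> is_shortest rho gam a b X Y ->
  exists p, geodesic rho p (rho X Y) X Y.
Proof.
  intros (Hpos & Hzero & Hsym & Htri) (Hab & Hc & HX & HY & Hlub).
  set (f := fun t => rho X (gam (clamp a b t))).
  assert (Cf : Ranalysis1.continuity f).
  { intros t eps Heps.
    destruct (Hc (clamp a b t) (clamp_bound a b t Hab) eps Heps) as (del & Hdel & H).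
    exists del. split; [exact Hdel|]. intros s [_ Hs]. simpl in *. unfold Rdist in *.
    unfold f.
    assert (H' : rho (gam (clamp a b t)) (gam (clamp a b s)) < eps).
    { apply H; [apply clamp_bound, Hab|].
      apply Rle_lt_trans with (2 := Hs), clamp_contract. }
    pose proof (Htri X (gam (clamp a b t)) (gam (clamp a b s))) as T1.
    pose proof (Htri X (gam (clamp a b s)) (gam (clamp a b t))) as T2.
    rewrite (Hsym (gam (clamp a b s))) in T2.
    apply Rabs_def1; lra. }
  assert (Ea : f a = 0).
  { unfold f. rewrite clamp_id by lra. apply Hzero. now symmetry. }
  assert (Eb : f b = rho X Y).
  { unfold f. rewrite clamp_id by lra. now rewrite HY. }
  (* Stated for every real [s], with no demand outside the interval, so that choice gives a function
     on the whole line. *)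
  assert (Hex : forall s, exists P, 0 <= s <= rho X Y ->
            exists t, a <= t <= b /\ gam t = P /\ rho X P = s).
  { intros s. destruct (classic (0 <= s <= rho X Y)) as [Hs|Hs].
    - destruct (IVT_gen f a b s Cf) as [t [Ht Et]].
      { rewrite Ea, Eb, Rmin_left, Rmax_right; lra. }
      rewrite Rmin_left, Rmax_right in Ht by lra.
      exists (gam t). intros _. exists t. split; [exact Ht|]. split; [reflexivity|].
      unfold f in Et. now rewrite clamp_id in Et by exact Ht.
    - exists X. intros; contradiction. }
  destruct (functional_choice _ Hex) as [p Hp].
  assert (Hmid : forall t t', a <= t -> t <= t' -> t' <= b ->
            rho X (gam t) + rho (gam t) (gam t') <= rho X (gam t')).
  { intros t t' H1 H2 H3. destruct Hlub as [Hub _].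
    specialize (Hub (rho (gam a) (gam t) + (rho (gam t) (gam t') +
                     (rho (gam t') (gam b) + 0)))).
    assert (Hle : rho (gam a) (gam t) + (rho (gam t) (gam t') +
                     (rho (gam t') (gam b) + 0)) <= rho X Y).
    { apply Hub. exists (t :: t' :: b :: nil). simpl. repeat split; lra. }
    rewrite HX, HY in Hle. pose proof (Htri X (gam t') Y). lra. }
  exists p. split; [apply Hpos|]. split; [|split].
  - destruct (Hp 0) as (t & _ & _ & E0); [pose proof (Hpos X Y); lra|].
    symmetry. now apply Hzero.
  - destruct (Hp (rho X Y)) as (t & Ht & Et & E0); [pose proof (Hpos X Y); lra|].
    pose proof (Hmid t b ltac:(lra) ltac:(lra) ltac:(lra)) as H.
    rewrite HY, Et, E0 in H. apply Hzero. pose proof (Hpos (p (rho X Y)) Y). lra.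
  - intros s t Hs Ht.
    destruct (Hp s Hs) as (u & Hu & Eu & Es).
    destruct (Hp t Ht) as (v & Hv & Ev & Et).
    destruct (Rle_dec u v) as [h|h].
    + pose proof (Hmid u v ltac:(lra) h ltac:(lra)) as H.
      rewrite Eu, Ev, Es, Et in H. pose proof (Htri X (p s) (p t)) as T.
      pose proof (Hpos (p s) (p t)).
      rewrite Rabs_left1; lra.
    + pose proof (Hmid v u ltac:(lra) ltac:(lra) ltac:(lra)) as H.
      rewrite Eu, Ev, Es, Et in H. pose proof (Htri X (p t) (p s)) as T.
      pose proof (Hpos (p t) (p s)).
      rewrite Hsym, Rabs_right; lra.
Qed.

(** * Upper angles between geodesics *)

(* The upper angle in terms of the arc length parameters of two geodesics
   issuing from [p 0]; unlike [upper_angle] it visibly depends only on the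
   germs of [p] and [q] at [0]. *)
Definition geodesic_angle {M : Type} (rho : M -> M -> R) (p q : R -> M) (al : R) : Prop :=
  (forall eps, 0 < eps -> exists del, 0 < del /\
     forall s t, 0 < s < del -> 0 < t < del ->
       eucl_angle rho (p s) (p 0) (q t) <= al + eps) /\
  (forall eps del, 0 < eps -> 0 < del ->
     exists s t, 0 < s < del /\ 0 < t < del /\
       al - eps <= eucl_angle rho (p s) (p 0) (q t)).

(** The angle is the infimum of the eventual upper bounds; they are negated because [completeness]
    provides suprema. *)
Lemma geodesic_angle_exists {M : Type} (rho : M -> M -> R) (p q : R -> M) :
  exists al, geodesic_angle rho p q al.
Proof.
  set (E := fun s t => eucl_angle rho (p s) (p 0) (q t)).
  set (S := fun b => exists del, 0 < del /\
              forall s t, 0 < s < del -> 0 < t < del -> E s t <= - b).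
  assert (B : bound S).
  { exists 0. intros b (del & Hdel & H).
    specialize (H (del / 2) (del / 2) ltac:(lra) ltac:(lra)).
    unfold E, eucl_angle in H.
    match type of H with acos ?u <= _ => pose proof (acos_bound u) end. lra. }
  assert (N : exists b, S b).
  { exists (- PI). exists 1. split; [lra|]. intros s t _ _. unfold E, eucl_angle.
    match goal with |- acos ?u <= _ => pose proof (acos_bound u) end. lra. }
  destruct (completeness S B N) as [m [Hub Hlub]].
  exists (- m). split.
  - intros eps Heps. apply NNPP. intros Hn.
    assert (m <= m - eps); [|lra].
    apply Hlub. intros b Hb. apply Rnot_lt_le. intros Hlt. apply Hn.
    destruct Hb as (del & Hdel & H). exists del. split; [exact Hdel|].
    intros s t Hs Ht. specialize (H s t Hs Ht). unfold E in H. lra.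
  - intros eps del Heps Hdel. apply NNPP. intros Hn.
    assert (m + eps <= m); [|lra].
    apply Hub. exists del. split; [exact Hdel|].
    intros s t Hs Ht. apply Rnot_lt_le. intros Hlt. apply Hn.
    exists s, t. split; [exact Hs|]. split; [exact Ht|]. unfold E in Hlt. lra.
Qed.

Lemma geodesic_angle_bound {M : Type} (rho : M -> M -> R) (p q : R -> M) al :
  geodesic_angle rho p q al -> 0 <= al <= PI.
Proof.
  intros [H1 H2]. split; apply le_epsilon; intros eps Heps.
  - destruct (H1 eps Heps) as (del & Hdel & H).
    specialize (H (del / 2) (del / 2) ltac:(lra) ltac:(lra)).
    unfold eucl_angle in H.
    match type of H with acos ?u <= _ => pose proof (acos_bound u) end. lra.
  - destruct (H2 eps 1 Heps ltac:(lra)) as (s & t & _ & _ & H).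
    unfold eucl_angle in H.
    match type of H with _ <= acos ?u => pose proof (acos_bound u) end. lra.
Qed.

(** On a geodesic from [O], the distance from [O] is the parameter, so the two limits agree. [Ls]
    and [Ns] are given by extension so that the image of a reversed parametrisation also fits. *)
Lemma geodesic_angle_upper_angle {M : Type} (rho : M -> M -> R) p q l m O X Y
    (Ls Ns : M -> Prop) al :
  is_metric rho -> geodesic rho p l O X -> geodesic rho q m O Y -> 0 < l -> 0 < m ->
  (forall P, Ls P <-> exists s, 0 <= s <= l /\ p s = P) ->
  (forall P, Ns P <-> exists s, 0 <= s <= m /\ q s = P) ->
  geodesic_angle rho p q al -> upper_angle rho O Ls Ns al.
Proof.
  intros (Hpos & Hzero & Hsym & Htri) Gp Gq Hl Hm HL HN [A1 A2].
  pose proof Gp as (_ & Hp0 & _).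
  split.
  - intros s (del & Hdel & Hub & _). apply le_epsilon. intros eps Heps.
    destruct (A2 eps (Rmin del (Rmin l m)) Heps) as (u & v & Hu & Hv & H).
    { repeat apply Rmin_pos; lra. }
    pose proof (Rmin_l del (Rmin l m)). pose proof (Rmin_r del (Rmin l m)).
    pose proof (Rmin_l l m). pose proof (Rmin_r l m).
    pose proof (geodesic_dist_start _ _ _ _ _ u Gp ltac:(lra)) as Eu.
    pose proof (geodesic_dist_start _ _ _ _ _ v Gq ltac:(lra)) as Ev.
    assert (Hle : eucl_angle rho (p u) (p 0) (q v) <= s); [|lra].
    apply Hub. exists (p u), (q v). rewrite Hp0, Eu, Ev.
    repeat split; try lra.
    + apply HL. exists u. split; [lra | reflexivity].
    + intros E. rewrite E in Eu. assert (rho O O = 0) by now apply Hzero. lra.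
    + apply HN. exists v. split; [lra | reflexivity].
    + intros E. rewrite E in Ev. assert (rho O O = 0) by now apply Hzero. lra.
  - intros w Hw. apply le_epsilon. intros eps Heps.
    destruct (A1 eps Heps) as (del & Hdel & H).
    set (S := fun v => exists X Y, Ls X /\ X <> O /\ rho O X < del /\
                Ns Y /\ Y <> O /\ rho O Y < del /\ v = eucl_angle rho X O Y).
    assert (Bd : is_upper_bound S (al + eps)).
    { intros v (P & Q & HP & HPO & HPd & HQ & HQO & HQd & ->).
      apply HL in HP. destruct HP as (s & Hs & <-).
      apply HN in HQ. destruct HQ as (t & Ht & <-).
      rewrite (geodesic_dist_start _ _ _ _ _ s Gp Hs) in HPd.
      rewrite (geodesic_dist_start _ _ _ _ _ t Gq Ht) in HQd.
      rewrite <- Hp0. apply H; split; try assumption.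
      - destruct (Req_dec s 0) as [->|]; [contradiction | lra].
      - destruct (Req_dec t 0) as [->|]; [|lra].
        destruct Gq as (_ & Hq0 & _). contradiction. }
    destruct (completeness S) as [sup [Hs1 Hs2]].
    + now exists (al + eps).
    + set (h := Rmin (del / 2) (Rmin l m)).
      assert (Hh : 0 < h) by (unfold h; repeat apply Rmin_pos; lra).
      assert (h <= del / 2) by apply Rmin_l.
      assert (h <= Rmin l m) by apply Rmin_r.
      pose proof (Rmin_l l m). pose proof (Rmin_r l m).
      pose proof (geodesic_dist_start _ _ _ _ _ h Gp ltac:(lra)) as Eu.
      pose proof (geodesic_dist_start _ _ _ _ _ h Gq ltac:(lra)) as Ev.
      exists (eucl_angle rho (p h) O (q h)), (p h), (q h).
      rewrite Eu, Ev. repeat split; try lra.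
      * apply HL. exists h. split; [lra | reflexivity].
      * intros E. rewrite E in Eu. assert (rho O O = 0) by now apply Hzero. lra.
      * apply HN. exists h. split; [lra | reflexivity].
      * intros E. rewrite E in Ev. assert (rho O O = 0) by now apply Hzero. lra.
    + apply Rle_trans with sup; [|apply Hs2, Bd].
      apply Hw. exists del. split; [exact Hdel|]. split; assumption.
Qed.

Lemma geodesic_angle_cos {M : Type} (rho : M -> M -> R) p q l m O X Y al c :
  is_metric rho -> geodesic rho p l O X -> geodesic rho q m O Y -> 0 < l -> 0 < m ->
  geodesic_angle rho p q al -> c < cos al ->
  exists del, 0 < del /\ del <= l /\ del <= m /\
    forall s t, 0 < s < del -> 0 < t < del ->
      rho (p s) (q t) ^ 2 <= s ^ 2 + t ^ 2 - 2 * s * t * c.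
Proof.
  intros (Hpos & Hzero & Hsym & Htri) Gp Gq Hl Hm Ang Hc.
  pose proof (geodesic_angle_bound _ _ _ _ Ang) as Hal.
  pose proof Gp as (_ & Hp0 & _).
  (* Below -1, [acos c] is just [PI] and may equal [al], which leaves no epsilon; the triangle
     inequality alone gives the bound. *)
  destruct (Rlt_dec c (-1)) as [h|h].
  { exists (Rmin l m). split; [apply Rmin_pos; lra|].
    pose proof (Rmin_l l m). pose proof (Rmin_r l m).
    split; [lra|]. split; [lra|]. intros s t Hs Ht.
    pose proof (geodesic_dist_start _ _ _ _ _ s Gp ltac:(lra)) as Eu.
    pose proof (geodesic_dist_start _ _ _ _ _ t Gq ltac:(lra)) as Ev.
    pose proof (Htri (p s) O (q t)) as T. rewrite (Hsym _ O), Eu, Ev in T.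
    pose proof (Hpos (p s) (q t)).
    assert (0 < s * t) by nra. nra. }
  assert (Hlt : al < acos c).
  { pose proof (COS_bound al). apply Rnot_le_lt. intros Hle.
    pose proof (acos_bound c).
    assert (Hd : cos al <= cos (acos c)) by (apply cos_decr_1; lra).
    rewrite cos_acos in Hd by lra. lra. }
  destruct Ang as [A1 _].
  destruct (A1 (acos c - al) ltac:(lra)) as (del & Hdel & H).
  exists (Rmin del (Rmin l m)).
  pose proof (Rmin_l del (Rmin l m)). pose proof (Rmin_r del (Rmin l m)).
  pose proof (Rmin_l l m). pose proof (Rmin_r l m).
  split; [repeat apply Rmin_pos; lra|]. split; [lra|]. split; [lra|].
  intros s t Hs Ht. specialize (H s t ltac:(lra) ltac:(lra)).
  pose proof (geodesic_dist_start _ _ _ _ _ s Gp ltac:(lra)) as Eu.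
  pose proof (geodesic_dist_start _ _ _ _ _ t Gq ltac:(lra)) as Ev.
  unfold eucl_angle in H. rewrite Hp0, Eu, Ev in H.
  assert (Hst : 0 < 2 * s * t) by nra.
  assert (Hle : c <= (s ^ 2 + t ^ 2 - rho (p s) (q t) ^ 2) / (2 * s * t)).
  { apply Rnot_lt_le. intros Hn.
    replace (al + (acos c - al)) with (acos c) in H by ring.
    set (u := (s ^ 2 + t ^ 2 - rho (p s) (q t) ^ 2) / (2 * s * t)) in *.
    assert (-1 <= u).
    { unfold u. apply Rle_div_r; [lra|].
      pose proof (Htri (p s) O (q t)) as T. rewrite (Hsym _ O), Eu, Ev in T.
      pose proof (Hpos (p s) (q t)). nra. }
    assert (u <= 1) by (pose proof (COS_bound al); lra).
    pose proof (COS_bound al).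
    assert (cos (acos c) <= cos (acos u)).
    { pose proof (acos_bound c). pose proof (acos_bound u). apply cos_decr_1; lra. }
    rewrite !cos_acos in * by lra. lra. }
  apply Rle_div_r in Hle; lra.
Qed.

(** The correction [h ^ 2 / (2 * t)] is chosen so that the square of the right side exceeds the law
    of cosines by a perfect square. *)
Lemma eucl_side_bound (h t c r : R) :
  0 < t -> 0 <= h <= t -> c <= 1 -> 0 <= r ->
  r ^ 2 <= h ^ 2 + t ^ 2 - 2 * h * t * c -> r <= t - h * c + h ^ 2 / (2 * t).
Proof.
  intros Ht Hh Hc Hr H.
  assert (Hq : 0 <= h ^ 2 / (2 * t)).
  { apply Rmult_le_pos; [nra | apply Rlt_le, Rinv_0_lt_compat; lra]. }
  assert (E : (t - h * c + h ^ 2 / (2 * t)) ^ 2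
              = h ^ 2 + t ^ 2 - 2 * h * t * c + (h * c - h ^ 2 / (2 * t)) ^ 2)
    by (field; lra).
  pose proof (pow2_ge_0 (h * c - h ^ 2 / (2 * t))).
  assert (0 <= t - h * c + h ^ 2 / (2 * t)) by nra.
  nra.
Qed.

(** Detour from [p h] through [q (N * h)] to [Y]. A large [N] makes the quadratic error
    [h / (2 * N)] fit into the gap between [c] and [c'], while [N * h < del] keeps the angle bound
    in force. *)
Lemma first_variation {M : Type} (rho : M -> M -> R) p q l z O X Y al c :
  is_metric rho -> geodesic rho p l O X -> geodesic rho q z O Y -> 0 < l -> 0 < z ->
  geodesic_angle rho p q al -> c < cos al ->
  exists h0, 0 < h0 /\ forall h, 0 < h < h0 -> rho (p h) Y <= z - c * h.
Proof.
  intros HM Gp Gq Hl Hz Ang Hc.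
  set (c' := (c + cos al) / 2).
  assert (Hc' : c < c' < cos al) by (unfold c'; lra).
  destruct (geodesic_angle_cos rho p q l z O X Y al c' HM Gp Gq Hl Hz Ang)
    as (del & Hdel & Hdl & Hdz & H); [lra|].
  set (N := Rmax 1 (/ (c' - c))).
  assert (HN1 : 1 <= N) by apply Rmax_l.
  assert (HN2 : / (c' - c) <= N) by apply Rmax_r.
  exists (del / N).
  assert (HdN : 0 < del / N) by (apply Rdiv_lt_0_compat; lra).
  split; [exact HdN|]. intros h Hh.
  assert (Ht : 0 < N * h < del).
  { split; [nra|]. destruct Hh as [_ Hh]. apply Rlt_div_r in Hh; [|lra]. lra. }
  pose proof HM as (Hpos & Hzero & Hsym & Htri).
  pose proof (COS_bound al).
  assert (B : rho (p h) (q (N * h)) <= N * h - h * c' + h ^ 2 / (2 * (N * h))).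
  { apply eucl_side_bound; [lra | nra | lra | apply Hpos |].
    apply H; [nra | exact Ht]. }
  pose proof (geodesic_dist_end _ _ _ _ _ (N * h) Gq ltac:(lra)) as E.
  pose proof (Htri (p h) (q (N * h)) Y) as T.
  assert (F : h ^ 2 / (2 * (N * h)) <= h * (c' - c)).
  { apply Rle_div_l; [nra|].
    assert (1 <= N * (c' - c)).
    { apply Rmult_le_reg_r with (/ (c' - c)); [apply Rinv_0_lt_compat; lra|].
      rewrite Rmult_assoc, Rinv_r by lra. lra. }
    nra. }
  lra.
Qed.

(** This says that the two angles add up to at least [PI]: otherwise the way from [p1 h] to [p2 h]
    through a point of [q] near [O] would be shorter than [2 * h]. *)
Lemma opposite_angles {M : Type} (rho : M -> M -> R) p1 p2 q l1 l2 m O X1 X2 Y al1 al2 :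
  is_metric rho -> geodesic rho p1 l1 O X1 -> geodesic rho p2 l2 O X2 ->
  geodesic rho q m O Y -> 0 < l1 -> 0 < l2 -> 0 < m ->
  (forall h, 0 <= h <= l1 -> h <= l2 -> rho (p1 h) (p2 h) = 2 * h) ->
  geodesic_angle rho p1 q al1 -> geodesic_angle rho p2 q al2 ->
  cos al1 + cos al2 <= 0.
Proof.
  intros HM G1 G2 Gq Hl1 Hl2 Hm Hopp A1 A2.
  apply Rnot_lt_le. intros Hs.
  (* With slack [e] in each cosine and [t = e * h], the detour has length at most
     [2 * h - t * e]. *)
  set (e := (cos al1 + cos al2) / 4).
  pose proof (COS_bound al1). pose proof (COS_bound al2).
  destruct (geodesic_angle_cos rho p1 q l1 m O X1 Y al1 (cos al1 - e) HM G1 Gq Hl1 Hm A1)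
    as (d1 & Hd1 & Hd1l & Hd1m & H1); [unfold e; lra|].
  destruct (geodesic_angle_cos rho p2 q l2 m O X2 Y al2 (cos al2 - e) HM G2 Gq Hl2 Hm A2)
    as (d2 & Hd2 & Hd2l & Hd2m & H2); [unfold e; lra|].
  pose proof HM as (Hpos & Hzero & Hsym & Htri).
  set (h := Rmin d1 d2 / 2).
  pose proof (Rmin_l d1 d2). pose proof (Rmin_r d1 d2).
  assert (0 < Rmin d1 d2) by (apply Rmin_pos; lra).
  assert (Hh : 0 < h < d1 /\ h < d2) by (unfold h; lra).
  assert (He : 0 < e <= 1 / 2) by (unfold e; lra).
  set (t := e * h).
  assert (Ht : 0 < t <= h) by (unfold t; nra).
  assert (B1 : rho (p1 h) (q t) <= h - t * (cos al1 - e) + t ^ 2 / (2 * h)).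
  { apply eucl_side_bound; [lra | lra | lra | apply Hpos |].
    specialize (H1 h t ltac:(lra) ltac:(lra)). lra. }
  assert (B2 : rho (p2 h) (q t) <= h - t * (cos al2 - e) + t ^ 2 / (2 * h)).
  { apply eucl_side_bound; [lra | lra | lra | apply Hpos |].
    specialize (H2 h t ltac:(lra) ltac:(lra)). lra. }
  pose proof (Htri (p1 h) (q t) (p2 h)) as T.
  rewrite Hopp, (Hsym (q t)) in T by lra.
  assert (F : t ^ 2 / (2 * h) = t * e / 2) by (unfold t; field; lra).
  rewrite F in *. assert (0 < t * e) by nra.
  assert (E4 : cos al1 + cos al2 = 4 * e) by (unfold e; field).
  assert (t * (cos al1 + cos al2) = 4 * (t * e)) by (rewrite E4; ring).
  lra.
Qed.

Lemma geodesic_angle_sym {M : Type} (rho : M -> M -> R) p q al :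
  is_metric rho -> p 0 = q 0 -> geodesic_angle rho p q al -> geodesic_angle rho q p al.
Proof.
  intros (_ & _ & Hsym & _) H0 [A1 A2].
  assert (E : forall s t, eucl_angle rho (q s) (q 0) (p t) = eucl_angle rho (p t) (p 0) (q s)).
  { intros s t. unfold eucl_angle. rewrite <- H0, (Hsym (q s) (p t)). f_equal.
    replace (2 * rho (p 0) (p t) * rho (p 0) (q s))
      with (2 * rho (p 0) (q s) * rho (p 0) (p t)) by ring. f_equal. ring. }
  split.
  - intros eps Heps. destruct (A1 eps Heps) as (del & Hdel & H).
    exists del. split; [exact Hdel|]. intros s t Hs Ht. rewrite E. now apply H.
  - intros eps del Heps Hdel. destruct (A2 eps del Heps Hdel) as (s & t & Hs & Ht & H).
    exists t, s. rewrite E. auto.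
Qed.

(** * Comparison of angles *)

Lemma RK_metric {M : Type} (rho : M -> M -> R) K : is_RK_domain rho K -> is_metric rho.
Proof. now intros []. Qed.

Lemma RK_geodesic {M : Type} (rho : M -> M -> R) K X Y :
  is_RK_domain rho K -> exists p, geodesic rho p (rho X Y) X Y.
Proof.
  intros (HM & Hsh & _). destruct (Hsh X Y) as (gam & a & b & H).
  exact (shortest_geodesic rho gam a b X Y HM H).
Qed.

Lemma metric_dist_pos {M : Type} (rho : M -> M -> R) X Y :
  is_metric rho -> X <> Y -> 0 < rho X Y.
Proof.
  intros (Hpos & Hzero & _) H. destruct (Hpos X Y) as [h|h]; [exact h|].
  symmetry in h. apply Hzero in h. contradiction.
Qed.

(** The perimeter condition, applied to [X], [Y] and the midpoint of a geodesic between them, bounds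
    [2 * rho X Y]. *)
Lemma RK_in_range {M : Type} (rho : M -> M -> R) K X Y :
  K <> 0 -> is_RK_domain rho K -> in_range K (rho X Y).
Proof.
  intros HK HD h. pose proof (curv_rate_pos K HK) as Hk.
  pose proof (RK_metric rho K HD) as HM.
  pose proof HM as (Hpos & Hzero & Hsym & Htri).
  destruct (classic (X = Y)) as [<-|Hn].
  { assert (E : rho X X = 0) by now apply Hzero.
    rewrite E. pose proof PI_RGT_0. lra. }
  pose proof (metric_dist_pos rho X Y HM Hn) as Hl.
  destruct (RK_geodesic rho K X Y HD) as [p G].
  set (l := rho X Y) in *.
  pose proof (geodesic_dist_start _ _ _ _ _ (l / 2) G ltac:(lra)) as E1.
  pose proof (geodesic_dist_end _ _ _ _ _ (l / 2) G ltac:(lra)) as E2.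
  destruct HD as (_ & _ & Hper & _).
  specialize (Hper h X (p (l / 2)) Y).
  rewrite E1, E2, (Hsym Y X) in Hper. fold l in Hper.
  assert (Hp : l / 2 + (l - l / 2) + l < 2 * PI / sqrt K).
  { apply Hper; [| |exact Hn].
    - intros E. rewrite <- E in E1. assert (rho X X = 0) by now apply Hzero. lra.
    - intros E. rewrite E in E2. assert (rho Y Y = 0) by now apply Hzero. lra. }
  replace (sqrt K) with (curv_rate K) in Hp
    by (unfold curv_rate; rewrite Rabs_right; lra).
  apply Rlt_div_r in Hp; lra.
Qed.

Lemma RK_model_triangle {M : Type} (rho : M -> M -> R) K X Y Z :
  K <> 0 -> is_RK_domain rho K -> model_triangle K (rho X Y) (rho X Z) (rho Y Z).
Proof.
  intros HK HD. pose proof (curv_rate_pos K HK) as Hk.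
  pose proof (RK_metric rho K HD) as (Hpos & Hzero & Hsym & Htri).
  repeat split; try apply Hpos.
  - rewrite (Hsym Y Z). apply Htri.
  - apply Htri.
  - rewrite (Hsym X Y). apply Htri.
  - intros h.
    assert (E : forall P, rho P P = 0) by (intros; now apply Hzero).
    destruct (classic (X = Y)) as [<-|H1].
    { rewrite E. pose proof (RK_in_range rho K X Z HK HD h). lra. }
    destruct (classic (X = Z)) as [<-|H2].
    { rewrite E, (Hsym Y X). pose proof (RK_in_range rho K X Y HK HD h). lra. }
    destruct (classic (Y = Z)) as [<-|H3].
    { rewrite E. pose proof (RK_in_range rho K X Y HK HD h). lra. }
    destruct HD as (_ & _ & Hper & _).
    specialize (Hper h X Y Z H1 H3 H2). rewrite (Hsym Z X) in Hper.
    replace (sqrt K) with (curv_rate K) in Hper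
      by (unfold curv_rate; rewrite Rabs_right; lra).
    apply Rlt_div_r in Hper; lra.
Qed.

Lemma RK_snK {M : Type} (rho : M -> M -> R) K X Y :
  K <> 0 -> is_RK_domain rho K -> X <> Y -> 0 < snK K (rho X Y).
Proof.
  intros HK HD Hn. apply snK_gt_0; [exact HK | | now apply RK_in_range].
  apply metric_dist_pos; [exact (RK_metric rho K HD) | exact Hn].
Qed.

Lemma RK_ang_cos_bound {M : Type} (rho : M -> M -> R) K X Y Z :
  K <> 0 -> is_RK_domain rho K -> X <> Y -> X <> Z ->
  -1 <= ang_cos K (rho X Y) (rho X Z) (rho Y Z) <= 1.
Proof.
  intros HK HD H1 H2. pose proof (RK_metric rho K HD) as HM.
  apply ang_cos_bound; [exact HK | now apply metric_dist_pos | now apply metric_dist_pos |].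
  now apply RK_model_triangle.
Qed.

(** Since [al] depends on germs only, the same [al] serves all pairs of points [X], [Y] on fixed
    geodesics [p], [q] from [O]. *)
Lemma RK_angle_sum {M : Type} (rho : M -> M -> R) K p q r O X Y al xi eta :
  K <> 0 -> is_RK_domain rho K -> O <> X -> O <> Y -> X <> Y ->
  geodesic rho p (rho O X) O X -> geodesic rho q (rho O Y) O Y ->
  geodesic rho r (rho X Y) X Y ->
  geodesic_angle rho p q al ->
  geodesic_angle rho (fun s => p (rho O X - s)) r xi ->
  geodesic_angle rho (fun s => q (rho O Y - s)) (fun s => r (rho X Y - s)) eta ->
  al + xi + eta <= acos (ang_cos K (rho O X) (rho O Y) (rho X Y))
                 + acos (ang_cos K (rho O X) (rho X Y) (rho O Y))
                 + acos (ang_cos K (rho O Y) (rho X Y) (rho O X)).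
Proof.
  intros HK HD HX HY HXY Gp Gq Gr Al Xi Eta.
  pose proof (RK_metric rho K HD) as HM.
  pose proof HM as (Hpos & Hzero & Hsym & Htri).
  pose proof (metric_dist_pos rho _ _ HM HX) as Px.
  pose proof (metric_dist_pos rho _ _ HM HY) as Py.
  pose proof (metric_dist_pos rho _ _ HM HXY) as Pz.
  rewrite <- !(model_angle_ang_cos K) by exact HK.
  pose proof (geodesic_rev _ _ _ _ _ Gp) as Gp'.
  pose proof (geodesic_rev _ _ _ _ _ Gq) as Gq'.
  pose proof (geodesic_rev _ _ _ _ _ Gr) as Gr'.
  destruct HD as (_ & _ & _ & Hsum).
  specialize (Hsum O X Y p r (fun s => q (rho O Y - s)) 0 (rho O X) 0 (rho X Y) 0 (rho O Y)
                al xi eta HX HXY HY).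
  unfold angK in Hsum. rewrite (Hsym X O), (Hsym Y O), (Hsym Y X) in Hsum.
  assert (Rev : forall (g : R -> M) l P, curve_image g 0 l P <->
            exists s, 0 <= s <= l /\ g (l - s) = P).
  { intros g l P. split; intros (s & Hs & E); exists (l - s); (split; [lra|]).
    - now replace (l - (l - s)) with s by ring.
    - exact E. }
  assert (Rev' : forall (g : R -> M) l P, curve_image (fun s => g (l - s)) 0 l P <->
            exists s, 0 <= s <= l /\ g s = P).
  { intros g l P. split; intros (s & Hs & E); exists (l - s); (split; [lra|]).
    - exact E.
    - now replace (l - (l - s)) with s by ring. }
  apply Hsum.
  - apply geodesic_is_shortest, Gp.
  - apply geodesic_is_shortest, Gr.
  - apply geodesic_is_shortest, Gq'.
  - eapply geodesic_angle_upper_angle; [exact HM | exact Gp | exact Gq | lra | lra | | | exact Al].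
    + intros P. reflexivity.
    + intros P. apply Rev'.
  - eapply geodesic_angle_upper_angle; [exact HM | exact Gp' | exact Gr | lra | lra | | | exact Xi].
    + intros P. apply Rev.
    + intros P. reflexivity.
  - eapply geodesic_angle_upper_angle;
      [exact HM | exact Gr' | exact Gq' | lra | lra | | |
       apply geodesic_angle_sym; [exact HM | | exact Eta]].
    + intros P. apply Rev.
    + intros P. reflexivity.
    + rewrite !Rminus_0_r. destruct Gq as (_ & _ & -> & _). now destruct Gr as (_ & _ & -> & _).
Qed.

(** * Sliding a vertex of a triangle towards [O] *)

Lemma is_derive_pos_right (f : R -> R) (d : R) :
  is_derive f 0 d -> 0 < d -> exists h0, 0 < h0 /\ forall h, 0 < h < h0 -> f 0 < f h.
Proof.
  intros D Hd. apply is_derive_Reals in D.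
  destruct (D (d / 2) ltac:(lra)) as [del H].
  exists del. split; [apply cond_pos|]. intros h Hh.
  specialize (H h ltac:(lra)). rewrite Rplus_0_l in H.
  rewrite Rabs_right in H by lra. specialize (H ltac:(lra)).
  apply Rabs_def2 in H. destruct H as [_ H].
  assert (0 < (f h - f 0) / h) as Hq by lra.
  apply Rmult_lt_compat_r with (r := h) in Hq; [|lra].
  unfold Rdiv in Hq. rewrite Rmult_assoc, Rinv_l in Hq by lra. lra.
Qed.

(* [x - h, z - c h] are the sides after the vertex [X] has been pushed a
   distance [h] towards [O]; the true third side is at most [z - c h] by the
   first variation inequality. *)
Lemma shrink_side {M : Type} (rho : M -> M -> R) K p r O X Y xi c :
  K <> 0 -> is_RK_domain rho K -> O <> X -> O <> Y -> X <> Y ->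
  geodesic rho p (rho O X) O X -> geodesic rho r (rho X Y) X Y ->
  geodesic_angle rho (fun s => p (rho O X - s)) r xi ->
  -1 <= c -> c < cos xi ->
  exists h0, 0 < h0 /\ h0 <= rho O X /\ forall h, 0 < h < h0 ->
    ang_cos K (rho O X - h) (rho O Y) (rho X Y - c * h)
    <= ang_cos K (rho O X - h) (rho O Y) (rho (p (rho O X - h)) Y).
Proof.
  intros HK HD HX HY HXY Gp Gr Xi Hc1 Hc.
  pose proof (RK_metric rho K HD) as HM.
  pose proof HM as (Hpos & Hzero & Hsym & Htri).
  pose proof (metric_dist_pos rho _ _ HM HX) as Px.
  pose proof (metric_dist_pos rho _ _ HM HXY) as Pz.
  pose proof (curv_rate_pos K HK) as Hk.
  destruct (first_variation rho _ r _ _ X O Y xi c HM (geodesic_rev _ _ _ _ _ Gp) Gr Px Pz Xi Hc)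
    as (h1 & Hh1 & H1).
  (* For negative [c] the bound [z - c * h] exceeds the side, but by at most [h] because [-1 <= c];
     for small [h] it stays within half a great circle, where the cosine is monotone. *)
  assert (exists h2, 0 < h2 /\ forall h, 0 < h < h2 -> 0 < K ->
            curv_rate K * (rho X Y - c * h) <= PI) as (h2 & Hh2 & H2).
  { destruct (Rlt_dec 0 K) as [h|h].
    - pose proof (RK_in_range rho K X Y HK HD h) as Hr.
      exists (PI / curv_rate K - rho X Y). split.
      + apply Rlt_0_minus. apply Rlt_div_r; lra.
      + intros e He _.
        assert (L : rho X Y + e <= PI / curv_rate K) by lra.
        apply Rle_div_r in L; [|lra].
        assert (0 <= curv_rate K * (e * (1 + c)))
          by (apply Rmult_le_pos; [lra|]; apply Rmult_le_pos; lra).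
        lra.
    - exists 1. split; [lra|]. intros; lra. }
  pose proof (Rmin_l h1 (Rmin h2 (rho O X))). pose proof (Rmin_r h1 (Rmin h2 (rho O X))).
  pose proof (Rmin_l h2 (rho O X)). pose proof (Rmin_r h2 (rho O X)).
  exists (Rmin h1 (Rmin h2 (rho O X))).
  split; [repeat apply Rmin_pos; lra|]. split; [lra|].
  intros h Hh. apply ang_cos_mono.
  - exact HK.
  - apply snK_gt_0; [exact HK | lra |]. intros hK.
    pose proof (RK_in_range rho K O X HK HD hK). nra.
  - now apply RK_snK.
  - apply Hpos.
  - apply H1. lra.
  - apply H2. lra.
Qed.

(** When the angle at [X] is below its comparison angle, a slide strictly raises the comparison
    cosine at [O], and the raised value is still at most 1. *)
Lemma shrink_lt_1 {M : Type} (rho : M -> M -> R) K p r O X Y xi :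
  K <> 0 -> is_RK_domain rho K -> O <> X -> O <> Y -> X <> Y ->
  geodesic rho p (rho O X) O X -> geodesic rho r (rho X Y) X Y ->
  geodesic_angle rho (fun s => p (rho O X - s)) r xi ->
  ang_cos K (rho O X) (rho X Y) (rho O Y) < cos xi ->
  ang_cos K (rho O X) (rho O Y) (rho X Y) < 1.
Proof.
  intros HK HD HX HY HXY Gp Gr Xi Hv.
  pose proof (RK_metric rho K HD) as HM.
  pose proof HM as (Hpos & Hzero & Hsym & Htri).
  pose proof (RK_snK rho K O X HK HD HX) as Sx.
  pose proof (RK_snK rho K O Y HK HD HY) as Sy.
  pose proof (RK_snK rho K X Y HK HD HXY) as Sz.
  set (v := ang_cos K (rho O X) (rho X Y) (rho O Y)) in *.
  assert (Bv : -1 <= v <= 1).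
  { unfold v. rewrite (Hsym O X). apply RK_ang_cos_bound; auto. }
  set (c := (v + cos xi) / 2).
  destruct (shrink_side rho K p r O X Y xi c HK HD HX HY HXY Gp Gr Xi)
    as (h0 & Hh0 & Hh0x & H); [unfold c; lra | unfold c; lra |].
  destruct (is_derive_pos_right _ _ (is_derive_ang_cos K _ _ _ c HK Sx Sy Sz))
    as (h1 & Hh1 & H1).
  { fold v. apply Rmult_lt_0_compat; [|unfold c; lra].
    apply Rdiv_lt_0_compat; nra. }
  set (h := Rmin h0 h1 / 2).
  pose proof (Rmin_l h0 h1). pose proof (Rmin_r h0 h1).
  assert (0 < Rmin h0 h1) by (apply Rmin_pos; lra).
  specialize (H h ltac:(unfold h; lra)). specialize (H1 h ltac:(unfold h; lra)).
  cbv beta in H1. rewrite Rmult_0_r, !Rminus_0_r in H1.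
  apply Rlt_le_trans with (1 := H1). apply Rle_trans with (1 := H).
  rewrite <- (geodesic_dist_start _ _ _ _ _ (rho O X - h) Gp) at 1 by (unfold h; lra).
  apply RK_ang_cos_bound; auto.
  intros E. pose proof (geodesic_dist_start _ _ _ _ _ (rho O X - h) Gp ltac:(unfold h; lra)) as E'.
  rewrite <- E in E'. assert (rho O O = 0) by now apply Hzero. unfold h in *. lra.
Qed.

(** To first order the comparison angle at [O] falls at a rate of at least [(c - v) / snK K x]: the
    law of sines absorbs the sine [S] from the derivative of [acos]. As [c - v > k * C] and
    [snK K x <= C * x], this beats the rate [k / x] at which [- k * ln] grows. The cap [h1] lets the
    caller stay inside its rectangle. *)
Lemma shrink_potential {M : Type} (rho : M -> M -> R) K p r O X Y xi k C h1 :
  K <> 0 -> is_RK_domain rho K -> O <> X -> O <> Y -> X <> Y ->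
  geodesic rho p (rho O X) O X -> geodesic rho r (rho X Y) X Y ->
  geodesic_angle rho (fun s => p (rho O X - s)) r xi ->
  0 < k -> 0 < h1 -> snK K (rho O X) <= C * rho O X ->
  ang_cos K (rho O X) (rho X Y) (rho O Y) + k * C < cos xi ->
  -1 < ang_cos K (rho O X) (rho O Y) (rho X Y) < 1 ->
  exists h, 0 < h < h1 /\ h < rho O X /\
    acos (ang_cos K (rho O X - h) (rho O Y) (rho (p (rho O X - h)) Y)) - k * ln (rho O X - h)
    < acos (ang_cos K (rho O X) (rho O Y) (rho X Y)) - k * ln (rho O X).
Proof.
  intros HK HD HX HY HXY Gp Gr Xi Hk Hh1 HC Hv Hu.
  pose proof (RK_metric rho K HD) as HM.
  pose proof HM as (Hpos & Hzero & Hsym & Htri).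
  pose proof (metric_dist_pos rho _ _ HM HX) as Px.
  pose proof (RK_snK rho K O X HK HD HX) as Sx.
  pose proof (RK_snK rho K O Y HK HD HY) as Sy.
  pose proof (RK_snK rho K X Y HK HD HXY) as Sz.
  pose proof (model_sine_law K _ _ _ HK Sx Sy Sz) as Sine.
  assert (HC0 : 0 < C) by nra.
  assert (Bv : -1 <= ang_cos K (rho O X) (rho X Y) (rho O Y) <= 1).
  { rewrite (Hsym O X). apply RK_ang_cos_bound; auto. }
  set (x := rho O X) in *. set (y := rho O Y) in *. set (z := rho X Y) in *.
  set (v := ang_cos K x z y) in *. set (u := ang_cos K x y z) in *.
  assert (HkC : 0 < k * C) by nra.
  set (c := (v + k * C + cos xi) / 2).
  assert (Hc : v + k * C < c < cos xi) by (unfold c; lra).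
  destruct (shrink_side rho K p r O X Y xi c HK HD HX HY HXY Gp Gr Xi)
    as (h0 & Hh0 & Hh0x & H); [lra | lra |]. fold x y z in H, Hh0x.
  set (S := sqrt (1 - u ^ 2)).
  assert (HS : 0 < S) by (apply sqrt_lt_R0; nra).
  assert (HS2 : S ^ 2 = 1 - u ^ 2) by (unfold S; rewrite pow2_sqrt; nra).
  set (d := snK K z / (snK K x * snK K y) * (c - v)).
  assert (D : is_derive (fun h => k * ln (x - h) - acos (ang_cos K (x - h) y (z - c * h))) 0
                (- (k / x) + d / S)).
  { replace (- (k / x) + d / S) with (minus (k * (- / x)) (scal d (- / S))).
    - apply @is_derive_minus.
      + apply is_derive_scal. auto_derive; [lra | field; lra].
      + apply (is_derive_comp acos (fun h => ang_cos K (x - h) y (z - c * h))).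
        * rewrite Rmult_0_r, !Rminus_0_r. apply is_derive_acos, Hu.
        * apply is_derive_ang_cos; assumption.
    - unfold minus, plus, opp, scal; simpl. unfold mult; simpl. field; lra. }
  destruct (is_derive_pos_right _ _ D) as (h2 & Hh2 & H2).
  { (* law of sines: snK z >= snK y * sin(angle at O) *)
    assert (L : snK K y * S <= snK K z).
    { assert ((snK K y * S) ^ 2 <= snK K z ^ 2).
      { rewrite Rpow_mult_distr, HS2, <- Sine. pose proof (pow2_ge_0 (snK K z)).
        pose proof (pow2_ge_0 v). nra. }
      assert (0 < snK K y * S) by nra. nra. }
    assert (E : d / S = snK K z * (c - v) / (snK K x * (snK K y * S)))
      by (unfold d; field; repeat split; lra).
    assert (k / x < d / S); [|lra].
    apply Rlt_le_trans with ((c - v) / snK K x).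
    - apply Rlt_div_l; [lra|]. unfold Rdiv.
      replace ((c - v) * / snK K x * x) with ((c - v) * x / snK K x) by (unfold Rdiv; ring).
      apply Rlt_div_r; [lra|]. nra.
    - assert (P : 0 < snK K x * (snK K y * S)) by (repeat apply Rmult_lt_0_compat; lra).
      rewrite E. apply (proj1 (Rle_div_r _ _ _ P)).
      replace ((c - v) / snK K x * (snK K x * (snK K y * S)))
        with ((c - v) * (snK K y * S)) by (field; lra). nra. }
  set (h := Rmin (Rmin h0 h1) h2 / 2).
  pose proof (Rmin_l (Rmin h0 h1) h2). pose proof (Rmin_r (Rmin h0 h1) h2).
  pose proof (Rmin_l h0 h1). pose proof (Rmin_r h0 h1).
  assert (0 < Rmin (Rmin h0 h1) h2) by (repeat apply Rmin_pos; lra).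
  assert (Hh : 0 < h < h0 /\ h < h1 /\ h < h2) by (unfold h; lra).
  exists h. split; [lra|]. split; [lra|].
  specialize (H h ltac:(lra)). specialize (H2 h ltac:(lra)). cbv beta in H2.
  rewrite Rmult_0_r, !Rminus_0_r in H2.
  apply acos_decr in H. fold u in H2. lra.
Qed.

(** A cosine 1 means comparison angle 0 at [O], below [al]. The angle sum condition then forces the
    angle at [X] or [Y] below its comparison angle, and [shrink_lt_1] applies at that vertex. *)
Lemma nonzero_angle_nondegenerate {M : Type} (rho : M -> M -> R) K p q O X Y al :
  K <> 0 -> is_RK_domain rho K -> O <> X -> O <> Y -> X <> Y ->
  geodesic rho p (rho O X) O X -> geodesic rho q (rho O Y) O Y ->
  geodesic_angle rho p q al -> 0 < al ->
  ang_cos K (rho O X) (rho O Y) (rho X Y) < 1.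
Proof.
  intros HK HD HX HY HXY Gp Gq Al Hal.
  pose proof (RK_metric rho K HD) as HM.
  pose proof HM as (Hpos & Hzero & Hsym & Htri).
  destruct (RK_geodesic rho K X Y HD) as [r Gr].
  pose proof (geodesic_rev _ _ _ _ _ Gr) as Gr'.
  destruct (geodesic_angle_exists rho (fun s => p (rho O X - s)) r) as [xi Xi].
  destruct (geodesic_angle_exists rho (fun s => q (rho O Y - s)) (fun s => r (rho X Y - s)))
    as [eta Eta].
  pose proof (RK_angle_sum rho K p q r O X Y al xi eta HK HD HX HY HXY Gp Gq Gr Al Xi Eta) as Sum.
  pose proof (geodesic_angle_bound _ _ _ _ Xi) as Bxi.
  pose proof (geodesic_angle_bound _ _ _ _ Eta) as Beta.
  assert (Lt : forall a v, 0 <= a -> -1 <= v <= 1 -> a < acos v -> v < cos a).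
  { intros a v Ha Hv H. pose proof (acos_bound v). rewrite <- (cos_acos v Hv).
    apply cos_decreasing_1; lra. }
  destruct (RK_ang_cos_bound rho K O X Y HK HD HX HY) as [_ [Hu|Hu]]; [exact Hu|].
  rewrite Hu, acos_1 in Sum.
  destruct (Rlt_dec xi (acos (ang_cos K (rho O X) (rho X Y) (rho O Y)))) as [h|h].
  - apply (shrink_lt_1 rho K p r O X Y xi); try assumption.
    apply Lt; [lra | | exact h]. rewrite (Hsym O X). apply RK_ang_cos_bound; auto.
  - rewrite ang_cos_sym, (Hsym X Y). rewrite (Hsym X Y) in Gr', Eta.
    apply (shrink_lt_1 rho K q (fun s => r (rho Y X - s)) O Y X eta); try assumption; auto.
    apply Lt; [lra | | rewrite (Hsym Y X); lra].
    rewrite (Hsym O Y). apply RK_ang_cos_bound; auto.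
Qed.

Lemma nonzero_angle_lt_1 {M : Type} (rho : M -> M -> R) K p q O X Y al :
  K <> 0 -> is_RK_domain rho K -> O <> X -> O <> Y ->
  geodesic rho p (rho O X) O X -> geodesic rho q (rho O Y) O Y ->
  geodesic_angle rho p q al -> 0 < al ->
  ang_cos K (rho O X) (rho O Y) (rho X Y) < 1.
Proof.
  intros HK HD HX HY Gp Gq Al Hal.
  destruct (classic (X = Y)) as [<-|HXY].
  2: { now apply (nonzero_angle_nondegenerate rho K p q O X Y al). }
  (* If [p] and [q] end at the same point, the midpoint of [p] and that point form a degenerate
     triangle with cosine exactly 1, against the previous lemma. *)
  exfalso.
  pose proof (RK_metric rho K HD) as HM.
  pose proof HM as (Hpos & Hzero & Hsym & Htri).
  pose proof (metric_dist_pos rho _ _ HM HX) as Px.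
  set (x := rho O X) in *.
  pose proof (geodesic_dist_start _ _ _ _ _ (x / 2) Gp ltac:(lra)) as E1.
  pose proof (geodesic_dist_end _ _ _ _ _ (x / 2) Gp ltac:(lra)) as E2.
  assert (N1 : O <> p (x / 2)).
  { intros E. rewrite <- E in E1. assert (rho O O = 0) by now apply Hzero. lra. }
  assert (N2 : p (x / 2) <> X).
  { intros E. rewrite E in E2. assert (rho X X = 0) by now apply Hzero. lra. }
  pose proof (nonzero_angle_nondegenerate rho K p q O (p (x / 2)) X al) as H.
  rewrite E1, E2 in H. fold x in H.
  specialize (H HK HD N1 HX N2 (geodesic_initial _ _ _ _ _ (x / 2) Gp ltac:(lra)) Gq Al Hal).
  pose proof (RK_snK rho K _ _ HK HD N1) as S1. rewrite E1 in S1.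
  pose proof (RK_snK rho K _ _ HK HD HX) as S2. fold x in S2.
  assert (E : ang_cos K (x / 2) x (x - x / 2) = 1); [|lra].
  unfold ang_cos. rewrite csK_minus by exact HK. field. repeat split; lra.
Qed.

(** * Minimising the potential over side lengths *)

Lemma rectangle_min (F : R -> R -> R) (a b c d : R) :
  a <= b -> c <= d ->
  (forall x y, a <= x <= b -> c <= y <= d -> continuity_2d_pt F x y) ->
  exists x y, a <= x <= b /\ c <= y <= d /\
    forall u v, a <= u <= b -> c <= v <= d -> F x y <= F u v.
Proof.
  intros Hab Hcd HF.
  assert (UC : forall eps, 0 < eps -> exists del, 0 < del /\ forall s s' t t',
            Rabs (s' - s) < del -> Rabs (t' - t) < del ->
            Rabs (F (clamp a b s') (clamp c d t') - F (clamp a b s) (clamp c d t)) < eps).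
  { intros eps Heps.
    destruct (uniform_continuity_2d F a b c d HF (mkposreal eps Heps)) as [del H].
    exists del. split; [apply cond_pos|]. intros s s' t t' Hs Ht.
    apply H; try (apply clamp_bound; assumption).
    - apply Rle_lt_trans with (2 := Hs), clamp_contract.
    - apply Rle_lt_trans with (2 := Ht), clamp_contract. }
  assert (Hy : forall s, exists t, c <= t <= d /\
            forall v, c <= v <= d -> F (clamp a b s) t <= F (clamp a b s) v).
  { intros s.
    destruct (continuity_ab_min (fun t => F (clamp a b s) (clamp c d t)) c d Hcd)
      as (t & Ht & Htcd).
    - intros t _ eps Heps. destruct (UC eps Heps) as (del & Hdel & H).
      exists del. split; [exact Hdel|]. intros t' [_ Ht']. apply H; [|exact Ht'].
      rewrite Rminus_diag, Rabs_R0. exact Hdel.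
    - exists t. split; [exact Htcd|]. intros v Hv. specialize (Ht v Hv). cbv beta in Ht.
      rewrite !(clamp_id c d) in Ht by assumption. exact Ht. }
  (* [tau] need not be continuous, but the minimum over each column is, by uniform continuity of
     [F]. *)
  destruct (functional_choice _ Hy) as [tau Htau].
  destruct (continuity_ab_min (fun s => F (clamp a b s) (tau s)) a b Hab) as (x & Hx & Hxab).
  - intros s _ eps Heps. destruct (UC eps Heps) as (del & Hdel & H).
    exists del. split; [exact Hdel|]. intros s' [_ Hs']. simpl in *. unfold Rdist in *.
    destruct (Htau s) as [Ts Ms]. destruct (Htau s') as [Ts' Ms'].
    specialize (Ms _ Ts'). specialize (Ms' _ Ts).
    assert (Z : forall t, Rabs (t - t) < del) by (intros; rewrite Rminus_diag, Rabs_R0; exact Hdel).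
    pose proof (H s s' (tau s) (tau s) Hs' (Z _)) as H1.
    pose proof (H s s' (tau s') (tau s') Hs' (Z _)) as H2.
    rewrite !(clamp_id c d) in H1, H2 by assumption.
    apply Rabs_def2 in H1. apply Rabs_def2 in H2. apply Rabs_def1; lra.
  - exists x, (tau x). destruct (Htau x) as [Tx Mx].
    split; [exact Hxab|]. split; [exact Tx|]. intros u v Hu Hv.
    specialize (Hx u Hu). cbv beta in Hx. destruct (Htau u) as [_ Mu].
    specialize (Mu v Hv). rewrite !(clamp_id a b) in * by assumption. lra.
Qed.

Lemma snK_le_linear (K L : R) :
  K <> 0 -> exists C, 0 < C /\ forall x, 0 < x -> x <= L -> snK K x <= C * x.
Proof.
  intros HK. pose proof (curv_rate_pos K HK) as Hk.
  (* Bounds the derivative [csK] for either sign, a cosine being at most 1. *)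
  exists (cosh (curv_rate K * L)).
  split; [pose proof (cosh_ge_1 (curv_rate K * L)); lra|].
  intros x Hx HL.
  destruct (MVT_gen (snK K) 0 x (csK K)) as (c & Hc & E).
  - intros; apply is_derive_snK, HK.
  - intros t _. apply continuity_pt_filterlim.
    apply @ex_derive_continuous. exists (csK K t). apply is_derive_snK, HK.
  - rewrite Rmin_left, Rmax_right in Hc by lra.
    assert (Z : snK K 0 = 0).
    { pose proof (snK_opp K 0) as H. rewrite Ropp_0 in H. lra. }
    rewrite Z in E.
    assert (csK K c <= cosh (curv_rate K * L)).
    { unfold csK. destruct (Rlt_dec 0 K).
      - pose proof (COS_bound (curv_rate K * c)). pose proof (cosh_ge_1 (curv_rate K * L)). lra.
      - apply cosh_incr; nra. }
    nra.
Qed.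

Lemma continuity_pt_csK (K t : R) : K <> 0 -> continuity_pt (csK K) t.
Proof.
  intros HK. apply continuity_pt_filterlim, @ex_derive_continuous.
  eexists. apply is_derive_csK, HK.
Qed.

Lemma continuity_pt_snK (K t : R) : K <> 0 -> continuity_pt (snK K) t.
Proof.
  intros HK. apply continuity_pt_filterlim, @ex_derive_continuous.
  eexists. apply is_derive_snK, HK.
Qed.

Lemma continuity_2d_ang_cos (K : R) (z : R -> R -> R) (x y : R) :
  K <> 0 -> 0 < snK K x -> 0 < snK K y -> continuity_2d_pt z x y ->
  continuity_2d_pt (fun s t => ang_cos K s t (z s t)) x y.
Proof.
  intros HK Sx Sy Hz. unfold ang_cos, Rdiv.
  assert (I1 : forall f, continuity_pt f x -> continuity_2d_pt (fun s _ => f s) x y).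
  { intros f Hf. apply (continuity_1d_2d_pt_comp f (fun s _ => s)); [exact Hf|].
    apply continuity_2d_pt_id1. }
  assert (I2 : forall f, continuity_pt f y -> continuity_2d_pt (fun _ t => f t) x y).
  { intros f Hf. apply (continuity_1d_2d_pt_comp f (fun _ t => t)); [exact Hf|].
    apply continuity_2d_pt_id2. }
  apply continuity_2d_pt_mult.
  - apply continuity_2d_pt_minus.
    + apply (continuity_1d_2d_pt_comp (csK K)); [apply continuity_pt_csK, HK | exact Hz].
    + apply continuity_2d_pt_mult; [apply I1 | apply I2]; apply continuity_pt_csK, HK.
  - apply continuity_2d_pt_inv.
    + apply continuity_2d_pt_mult; [apply continuity_2d_pt_mult|].
      * apply continuity_2d_pt_const.
      * apply I1, continuity_pt_snK, HK.
      * apply I2, continuity_pt_snK, HK.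
    + repeat apply Rmult_integral_contrapositive_currified; lra.
Qed.

(** Clamping matters at the boundary of the rectangle, whose neighbourhoods contain parameters where
    [p] and [q] are not known to be isometric. *)
Lemma continuity_2d_dist {M : Type} (rho : M -> M -> R) p q l m O X Y x y :
  is_metric rho -> geodesic rho p l O X -> geodesic rho q m O Y ->
  continuity_2d_pt (fun s t => rho (p (clamp 0 l s)) (q (clamp 0 m t))) x y.
Proof.
  intros (Hpos & Hzero & Hsym & Htri) (Hl & _ & _ & Ip) (Hm & _ & _ & Iq) eps.
  assert (He : 0 < eps / 2) by (pose proof (cond_pos eps); lra).
  exists (mkposreal _ He). simpl. intros u v Hu Hv.
  pose proof (clamp_contract 0 l u x) as Cu. pose proof (clamp_contract 0 m v y) as Cv.
  rewrite <- Ip in Cu by (apply clamp_bound; assumption).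
  rewrite <- Iq in Cv by (apply clamp_bound; assumption).
  set (P := p (clamp 0 l u)) in *. set (P' := p (clamp 0 l x)) in *.
  set (Q := q (clamp 0 m v)) in *. set (Q' := q (clamp 0 m y)) in *.
  pose proof (Htri P P' Q). pose proof (Htri P' Q' Q).
  pose proof (Htri P' P Q'). pose proof (Htri P Q Q').
  rewrite (Hsym P' P), (Hsym Q' Q) in *.
  apply Rabs_def1; lra.
Qed.

Lemma ln_scale (x a : R) : 0 < x -> ln (x * exp a) = ln x + a.
Proof. intros Hx. rewrite ln_mult, ln_exp; [reflexivity | exact Hx | apply exp_pos]. Qed.

Lemma geodesic_angle_le_model {M : Type} (rho : M -> M -> R) K p q O X0 Y0 al :
  K <> 0 -> is_RK_domain rho K -> O <> X0 -> O <> Y0 ->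
  geodesic rho p (rho O X0) O X0 -> geodesic rho q (rho O Y0) O Y0 ->
  geodesic_angle rho p q al ->
  al <= acos (ang_cos K (rho O X0) (rho O Y0) (rho X0 Y0)).
Proof.
  intros HK HD HX HY Gp Gq Al. apply Rnot_lt_le. intros Hlt.
  pose proof (RK_metric rho K HD) as HM.
  pose proof HM as (Hpos & Hzero & Hsym & Htri).
  pose proof (metric_dist_pos rho _ _ HM HX) as Px.
  pose proof (metric_dist_pos rho _ _ HM HY) as Py.
  pose proof (RK_in_range rho K O X0 HK HD) as Rx.
  pose proof (RK_in_range rho K O Y0 HK HD) as Ry.
  pose proof (curv_rate_pos K HK) as Hk.
  pose proof (geodesic_angle_bound _ _ _ _ Al) as Bal.
  set (x0 := rho O X0) in *. set (y0 := rho O Y0) in *.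
  set (g0 := acos (ang_cos K x0 y0 (rho X0 Y0))) in *.
  assert (Bg0 : 0 <= g0 <= PI) by apply acos_bound.
  set (de := al - g0).
  destruct (snK_le_linear K (Rmax x0 y0) HK) as (C & HC & Hlin).
  (* An angle short by [de / 2] has a cosine larger by at least [2 * w], by [cos_gap]; [k] is chosen
     so that [k * C = w] stays strictly below this. *)
  set (w := sin (de / 2 / 2) ^ 2).
  assert (Hw : 0 < w) by (apply sin_half_sqr_pos; unfold de; lra).
  set (k := w / C).
  assert (Hk0 : 0 < k) by (apply Rdiv_lt_0_compat; lra).
  assert (HkC : k * C = w) by (unfold k; field; lra).
  (* Scaling a side by [exp a] raises [- k * ln] by [PI + 1], more than any change of angle can
     offset. *)
  set (a := - ((PI + 1) / k)).
  pose proof PI_RGT_0 as Hpi.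
  assert (Ha : k * a = - (PI + 1)) by (unfold a; field; lra).
  assert (Hea : exp a < 1).
  { rewrite <- exp_0. apply exp_increasing. nra. }
  pose proof (exp_pos a) as Hea0.
  set (x1 := x0 * exp a). set (y1 := y0 * exp a).
  assert (Hx1 : 0 < x1 < x0) by (unfold x1; nra).
  assert (Hy1 : 0 < y1 < y0) by (unfold y1; nra).
  set (G := fun s t => acos (ang_cos K s t (rho (p (clamp 0 x0 s)) (q (clamp 0 y0 t))))
                       - k * ln s - k * ln t).
  assert (Sn : forall s l, 0 < s <= l -> in_range K l -> 0 < snK K s).
  { intros s l Hs Hr. apply snK_gt_0; [exact HK | lra |].
    intros h. specialize (Hr h). nra. }
  destruct (rectangle_min G x1 x0 y1 y0) as (x & y & Hx & Hy & Hmin); [lra | lra | |].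
  { intros s t Hs Ht. unfold G. apply continuity_2d_pt_minus; [apply continuity_2d_pt_minus|].
    - apply (continuity_1d_2d_pt_comp acos).
      + apply continuity_pt_filterlim, continuous_acos.
      + apply (continuity_2d_ang_cos K (fun s t => rho (p (clamp 0 x0 s)) (q (clamp 0 y0 t)))).
        * exact HK.
        * apply (Sn s x0); [lra | exact Rx].
        * apply (Sn t y0); [lra | exact Ry].
        * apply (continuity_2d_dist rho p q x0 y0 O X0 Y0 s t HM Gp Gq).
    - apply (continuity_1d_2d_pt_comp (fun s => k * ln s) (fun s _ => s)).
      + apply continuity_pt_scal, continuity_pt_filterlim, @ex_derive_continuous.
        auto_derive. lra.
      + apply continuity_2d_pt_id1.
    - apply (continuity_1d_2d_pt_comp (fun s => k * ln s) (fun _ t => t)).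
      + apply continuity_pt_scal, continuity_pt_filterlim, @ex_derive_continuous.
        auto_derive. lra.
      + apply continuity_2d_pt_id2. }
  assert (EG : forall s t, x1 <= s <= x0 -> y1 <= t <= y0 ->
            G s t = acos (ang_cos K s t (rho (p s) (q t))) - k * ln s - k * ln t).
  { intros s t Hs Ht. unfold G. rewrite !clamp_id by lra. reflexivity. }
  assert (EX : p x0 = X0) by apply Gp. assert (EY : q y0 = Y0) by apply Gq.
  pose proof (Hmin x0 y0 ltac:(lra) ltac:(lra)) as H0.
  rewrite (EG x y), (EG x0 y0), EX, EY in H0 by lra. fold g0 in H0.
  set (g := acos (ang_cos K x y (rho (p x) (q y)))) in *.
  assert (Bg : 0 <= g <= PI) by apply acos_bound.
  assert (Lx : ln x <= ln x0) by (apply ln_le; lra).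
  assert (Ly : ln y <= ln y0) by (apply ln_le; lra).
  (* On a lower edge [G] exceeds its value at [(x0, y0)] by at least 1, so at the minimum both sides
     can still be shortened. *)
  assert (Hx' : x1 < x).
  { destruct Hx as [[h|h] _]; [exact h|]. exfalso.
    rewrite <- h in H0. unfold x1 in H0. rewrite ln_scale in H0 by lra. nra. }
  assert (Hy' : y1 < y).
  { destruct Hy as [[h|h] _]; [exact h|]. exfalso.
    rewrite <- h in H0. unfold y1 in H0. rewrite ln_scale in H0 by lra. nra. }
  (* The logarithms at the minimum do not exceed those at the corner, so the excess [al - g] is
     still at least [de]. *)
  assert (Hg : g <= g0) by nra.
  pose proof (geodesic_initial _ _ _ _ _ x Gp ltac:(lra)) as Gpx.
  pose proof (geodesic_initial _ _ _ _ _ y Gq ltac:(lra)) as Gqy.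
  pose proof (geodesic_length _ _ _ _ _ Gpx) as Ex.
  pose proof (geodesic_length _ _ _ _ _ Gqy) as Ey.
  set (X := p x) in *. set (Y := q y) in *.
  assert (NX : O <> X).
  { intros E. rewrite <- E in Ex. assert (rho O O = 0) by now apply Hzero. lra. }
  assert (NY : O <> Y).
  { intros E. rewrite <- E in Ey. assert (rho O O = 0) by now apply Hzero. lra. }
  pose proof Gpx as Gpx0. pose proof Gqy as Gqy0.
  rewrite <- Ex in Gpx0 at 1. rewrite <- Ey in Gqy0 at 1.
  assert (Hu1 : ang_cos K (rho O X) (rho O Y) (rho X Y) < 1).
  { apply (nonzero_angle_lt_1 rho K p q O X Y al); try assumption. lra. }
  assert (NXY : X <> Y).
  { intros E. rewrite <- E in Hu1.
    pose proof (RK_snK rho K O X HK HD NX) as Sx.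
    assert (EE : ang_cos K (rho O X) (rho O X) (rho X X) = 1); [|lra].
    assert (Z : rho X X = 0) by now apply Hzero.
    rewrite Z. replace 0 with (rho O X - rho O X) by ring.
    unfold ang_cos. rewrite csK_minus by exact HK. field. repeat split; lra. }
  (* A cosine -1 would give [g = PI], whereas [g <= g0 < al <= PI]. *)
  assert (Hu : -1 < ang_cos K (rho O X) (rho O Y) (rho X Y) < 1).
  { split; [|exact Hu1]. apply Rnot_le_lt. intros h.
    unfold g in Hg. rewrite <- Ex, <- Ey, acos_le_m1 in Hg by exact h. lra. }
  destruct (RK_geodesic rho K X Y HD) as [r Gr].
  pose proof (geodesic_rev _ _ _ _ _ Gr) as Gr'.
  destruct (geodesic_angle_exists rho (fun s => p (rho O X - s)) r) as [xi Xi].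
  destruct (geodesic_angle_exists rho (fun s => q (rho O Y - s)) (fun s => r (rho X Y - s)))
    as [eta Eta].
  pose proof (RK_angle_sum rho K p q r O X Y al xi eta HK HD NX NY NXY Gpx0 Gqy0 Gr Al Xi Eta)
    as Sum.
  pose proof (geodesic_angle_bound _ _ _ _ Xi) as Bxi.
  pose proof (geodesic_angle_bound _ _ _ _ Eta) as Beta.
  assert (Gap : forall b v, 0 <= b -> -1 <= v <= 1 -> b + de / 2 <= acos v -> v + k * C < cos b).
  { intros b v Hb Hv H. pose proof (acos_bound v).
    pose proof (cos_gap (de / 2) b (acos v) ltac:(unfold de; lra) Hb H ltac:(lra)) as Hgap.
    rewrite (cos_acos v Hv) in Hgap. fold w in Hgap. lra. }
  replace (acos (ang_cos K (rho O X) (rho O Y) (rho X Y))) with g in Sum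
    by (unfold g; now rewrite Ex, Ey).
  pose proof (Rmax_l x0 y0). pose proof (Rmax_r x0 y0).
  (* The deficits at [X] and [Y] add up to at least [de], so one of them is at least [de / 2];
     sliding that vertex takes [G] below its minimum. *)
  destruct (Rle_dec (xi + de / 2) (acos (ang_cos K (rho O X) (rho X Y) (rho O Y)))) as [h|h].
  - destruct (shrink_potential rho K p r O X Y xi k C (x - x1) HK HD NX NY NXY Gpx0 Gr Xi)
      as (e & He & Hex & Hdec).
    + exact Hk0.
    + lra.
    + rewrite Ex. apply Hlin; lra.
    + apply Gap; [lra | | exact h]. rewrite (Hsym O X). apply RK_ang_cos_bound; auto.
    + exact Hu.
    + rewrite Ex, Ey in Hdec. pose proof (Hmin (x - e) y ltac:(lra) ltac:(lra)) as Hm.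
      rewrite !EG in Hm by lra. fold X Y in Hm. lra.
  - rewrite (Hsym X Y) in Gr', Eta.
    destruct (shrink_potential rho K q (fun s => r (rho Y X - s)) O Y X eta k C (y - y1)
                HK HD NY NX (not_eq_sym NXY) Gqy0 Gr' Eta)
      as (e & He & Hex & Hdec).
    + exact Hk0.
    + lra.
    + rewrite Ey. apply Hlin; lra.
    + apply Gap; [lra | | rewrite (Hsym Y X); unfold de in *; lra].
      rewrite (Hsym O Y). apply RK_ang_cos_bound; auto.
    + rewrite ang_cos_sym, (Hsym Y X). exact Hu.
    + rewrite Ex, Ey in Hdec. pose proof (Hmin x (y - e) ltac:(lra) ltac:(lra)) as Hm.
      rewrite !EG in Hm by lra. fold X Y in Hm.
      rewrite (ang_cos_sym K (y - e)), (ang_cos_sym K y), (Hsym _ X), (Hsym Y X) in Hdec. lra.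
Qed.

(** * The quadrilateral inequality *)

(** The factor [K] gives the inequality the right direction for both signs. After adding the laws of
    cosines in the two halves, only [K ^ 2] times positive factors times the sum of the comparison
    cosines at the midpoint remains, and that sum is at most 0. *)
Lemma RK_median {M : Type} (rho : M -> M -> R) K p A B C :
  K <> 0 -> is_RK_domain rho K -> A <> B -> A <> C -> B <> C ->
  geodesic rho p (rho A C) A C ->
  K * (csK K (rho A B) + csK K (rho B C))
  <= K * (2 * csK K (rho A C / 2) * csK K (rho B (p (rho A C / 2)))).
Proof.
  intros HK HD HAB HAC HBC Gp.
  pose proof (RK_metric rho K HD) as HM.
  pose proof HM as (Hpos & Hzero & Hsym & Htri).
  pose proof (metric_dist_pos rho _ _ HM HAC) as Pf.
  set (f := rho A C) in *.
  pose proof (geodesic_rev _ _ _ _ _ (geodesic_initial _ _ _ _ _ (f / 2) Gp ltac:(lra))) as G1.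
  pose proof (geodesic_final _ _ _ _ _ (f / 2) Gp ltac:(lra)) as G2.
  replace (f - f / 2) with (f / 2) in G2 by lra.
  assert (Opp : forall h, 0 <= h <= f / 2 -> h <= f / 2 ->
            rho (p (f / 2 - h)) (p (f / 2 + h)) = 2 * h).
  { intros h Hh _. destruct Gp as (_ & _ & _ & Ip). rewrite Ip by lra.
    rewrite Rabs_left1; lra. }
  set (Z := p (f / 2)) in *.
  pose proof (geodesic_length _ _ _ _ _ G1) as E1.
  pose proof (geodesic_length _ _ _ _ _ G2) as E2.
  (* With [B] at the midpoint there is no angle to compare, and the two sides are equal. *)
  destruct (classic (B = Z)) as [->|HBZ].
  { assert (E0 : rho Z Z = 0) by now apply Hzero.
    rewrite (Hsym A Z), E1, E2, E0, csK_0. lra. }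
  assert (NA : Z <> A).
  { intros E. rewrite E in E1. assert (rho A A = 0) by now apply Hzero. lra. }
  assert (NC : Z <> C).
  { intros E. rewrite E in E2. assert (rho C C = 0) by now apply Hzero. lra. }
  assert (NB : Z <> B) by auto.
  destruct (RK_geodesic rho K Z B HD) as [q Gq].
  pose proof (metric_dist_pos rho _ _ HM NB) as Pm.
  destruct (geodesic_angle_exists rho (fun s => p (f / 2 - s)) q) as [t1 T1].
  destruct (geodesic_angle_exists rho (fun s => p (f / 2 + s)) q) as [t2 T2].
  assert (Hc : cos t1 + cos t2 <= 0).
  { apply (opposite_angles rho (fun s => p (f / 2 - s)) (fun s => p (f / 2 + s)) q
             (f / 2) (f / 2) (rho Z B) Z A C B t1 t2); try assumption; lra. }
  assert (G1' : geodesic rho (fun s => p (f / 2 - s)) (rho Z A) Z A) by now rewrite E1.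
  assert (G2' : geodesic rho (fun s => p (f / 2 + s)) (rho Z C) Z C) by now rewrite E2.
  pose proof (geodesic_angle_le_model rho K _ q Z A B t1 HK HD NA NB G1' Gq T1) as L1.
  pose proof (geodesic_angle_le_model rho K _ q Z C B t2 HK HD NC NB G2' Gq T2) as L2.
  pose proof (RK_ang_cos_bound rho K Z A B HK HD NA NB) as B1.
  pose proof (RK_ang_cos_bound rho K Z C B HK HD NC NB) as B2.
  pose proof (geodesic_angle_bound _ _ _ _ T1) as Bt1.
  pose proof (geodesic_angle_bound _ _ _ _ T2) as Bt2.
  pose proof (RK_snK rho K Z A HK HD NA) as SA.
  pose proof (RK_snK rho K Z C HK HD NC) as SC.
  pose proof (RK_snK rho K Z B HK HD NB) as SB.
  rewrite E1 in *. rewrite E2 in *.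
  assert (Le : forall t u, 0 <= t <= PI -> -1 <= u <= 1 -> t <= acos u -> u <= cos t).
  { intros t u Ht Hu H. pose proof (acos_bound u).
    rewrite <- (cos_acos u Hu). apply cos_decr_1; lra. }
  apply Le in L1; [|assumption|assumption]. apply Le in L2; [|assumption|assumption].
  pose proof (ang_cos_law K (f / 2) (rho Z B) (rho A B) HK SA SB) as C1.
  pose proof (ang_cos_law K (f / 2) (rho Z B) (rho C B) HK SA SB) as C2.
  rewrite (Hsym B C), (Hsym B Z), C1, C2.
  assert (P : 0 < K ^ 2 * (snK K (f / 2) * snK K (rho Z B))).
  { apply Rmult_lt_0_compat; [|apply Rmult_lt_0_compat; lra].
    rewrite <- Rsqr_pow2. apply Rsqr_pos_lt, HK. }
  set (u1 := ang_cos K (f / 2) (rho Z B) (rho A B)) in *.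
  set (u2 := ang_cos K (f / 2) (rho Z B) (rho C B)) in *.
  assert (K ^ 2 * (snK K (f / 2) * snK K (rho Z B)) * (u1 + u2) <= 0) by nra.
  lra.
Qed.

Theorem mainTheorem18 (M : Type) (rho : M -> M -> R) (K : R)
  (HK : K <> 0) (Hdom : is_RK_domain rho K) (A B C D : M)
  (HAB : A <> B) (HAC : A <> C) (HAD : A <> D)
  (HBC : B <> C) (HBD : B <> D) (HCD : C <> D)
  (Hper : 0 < K -> rho A B + rho B C + rho C D + rho D A < 2 * PI / sqrt K) :
  let kappa := sqrt (Rabs K) in
  let a := rho A B in let b := rho B C in let c := rho C D in
  let d := rho A D in let e := rho B D in let f := rho A C in
  (0 < K -> cos (kappa * a) + cos (kappa * b) + cos (kappa * c) + cos (kappa * d)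
            <= 4 * cos (kappa * e / 2) * cos (kappa * f / 2)) /\
  (K < 0 -> cosh (kappa * a) + cosh (kappa * b) + cosh (kappa * c) + cosh (kappa * d)
            >= 4 * cosh (kappa * e / 2) * cosh (kappa * f / 2)).
Proof.
  intros kappa a b c d e f.
  pose proof (RK_metric rho K Hdom) as HM.
  pose proof HM as (Hpos & Hzero & Hsym & Htri).
  pose proof (curv_rate_pos K HK) as Hk.
  destruct (RK_geodesic rho K A C Hdom) as [p Gp].
  pose proof (RK_median rho K p A B C HK Hdom HAB HAC HBC Gp) as M1.
  pose proof (RK_median rho K p A D C HK Hdom HAD HAC (not_eq_sym HCD) Gp) as M2.
  rewrite (Hsym D C) in M2. fold a b c d f in M1, M2.
  set (Z := p (f / 2)) in *.
  pose proof (Htri B Z D) as T. rewrite (Hsym Z D) in T. fold e in T.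
  pose proof (RK_in_range rho K B Z HK Hdom) as RB.
  pose proof (RK_in_range rho K D Z HK Hdom) as RD.
  pose proof (RK_in_range rho K A C HK Hdom) as RF. fold f in RF.
  pose proof (RK_in_range rho K B D HK Hdom) as RE. fold e in RE.
  pose proof (Hpos B Z) as PB. pose proof (Hpos D Z) as PD.
  assert (Pe : 0 <= e) by apply Hpos. assert (Pf : 0 <= f) by apply Hpos.
  change (curv_rate K) with kappa in Hk.
  unfold in_range in RB, RD, RF, RE. change (curv_rate K) with kappa in RB, RD, RF, RE.
  set (m := rho B Z) in *. set (n := rho D Z) in *.
  pose proof PI_RGT_0.
  assert (kappa * e <= kappa * m + kappa * n) by nra.
  assert (0 <= kappa * e) by nra. assert (0 <= kappa * f) by nra.
  assert (0 <= kappa * m) by nra. assert (0 <= kappa * n) by nra.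
  split; intros h.
  - specialize (RB h). specialize (RD h). specialize (RF h). specialize (RE h).
    rewrite !csK_pos in M1, M2 by exact h. change (curv_rate K) with kappa in M1, M2.
    apply Rmult_le_reg_l in M1; [|exact h]. apply Rmult_le_reg_l in M2; [|exact h].
    replace (kappa * (f / 2)) with (kappa * f / 2) in * by field.
    pose proof (form1 (kappa * m) (kappa * n)) as F.
    (* All distances are below half a great circle, which makes these half-argument cosines
       nonnegative and keeps the half sum below [PI], where the cosine decreases. *)
    assert (0 <= cos (kappa * f / 2)) by (apply cos_ge_0; lra).
    assert (0 <= cos (kappa * e / 2)) by (apply cos_ge_0; lra).
    assert (Hd : 0 <= cos ((kappa * m - kappa * n) / 2) <= 1).
    { split; [apply cos_ge_0; lra | apply COS_bound]. }
    assert (He : cos ((kappa * m + kappa * n) / 2) <= cos (kappa * e / 2))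
      by (apply cos_decr_1; lra).
    assert (Q : cos (kappa * m) + cos (kappa * n) <= 2 * cos (kappa * e / 2)).
    { rewrite F. set (u := cos ((kappa * m - kappa * n) / 2)) in *.
      pose proof (Rmult_le_compat_l u _ _ (proj1 Hd) He) as Q1.
      assert (Q2 : u * cos (kappa * e / 2) <= 1 * cos (kappa * e / 2))
        by (apply Rmult_le_compat_r; lra).
      lra. }
    apply (Rmult_le_compat_l (cos (kappa * f / 2))) in Q; [lra | assumption].
  - rewrite !csK_neg in M1, M2 by exact h. change (curv_rate K) with kappa in M1, M2.
    replace (kappa * (f / 2)) with (kappa * f / 2) in * by field.
    set (s := (kappa * m + kappa * n) / 2). set (t := (kappa * m - kappa * n) / 2).
    assert (F : cosh (kappa * m) + cosh (kappa * n) = 2 * cosh s * cosh t).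
    { replace (kappa * m) with (s + t) by (unfold s, t; field).
      replace (kappa * n) with (s - t) by (unfold s, t; field).
      rewrite cosh_plus, cosh_minus. ring. }
    pose proof (cosh_ge_1 (kappa * f / 2)). pose proof (cosh_ge_1 t).
    assert (cosh (kappa * e / 2) <= cosh s) by (apply cosh_incr; unfold s; lra).
    pose proof (cosh_ge_1 (kappa * e / 2)).
    assert (Q : 2 * cosh (kappa * e / 2) <= cosh (kappa * m) + cosh (kappa * n)).
    { rewrite F. assert (1 * cosh s <= cosh t * cosh s) by (apply Rmult_le_compat_r; lra). lra. }
    apply (Rmult_le_compat_l (cosh (kappa * f / 2))) in Q; [|lra].
    (* [M1] and [M2] carry the negative factor [K], so the comparison is made after multiplying by
       [- K]. *)
    apply Rle_ge, Rmult_le_reg_l with (- K); [lra|].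
    apply (Rmult_le_compat_l (- K)) in Q; [lra | lra].
Qed.
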